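(* Consider any $K$-armed bandit problem ($K\ge2$) whose reward distributions all belong to a known one-parameter exponential family $\mathcal F_m$ such that the log-partition function $b$ is twice differentiable with continuous second derivative $b''>0$ on $\Theta$, and such that every distribution in $\mathcal F_m$ has variance at most $\bar V<\infty$. Then the algorithm Exp-KL-MS satisfies $$\limsup_{T\to\infty}\frac{\mathrm{Reg}(T)}{\ln T}=\sum_{a\in[K]:\Delta_a>0}\frac{\Delta_a}{\mathrm{KL}(\mu_a,\mu_{\max})},$$ where $\Delta_a=\mu_{\max}-\mu_a$.
   Context: Exponential family: given a base measure $m$ on $\mathbb R$, $\mathcal F_m=\{p_\theta(dx)=m(dx)\exp(x\theta-b(\theta)):\theta\in\Theta\}$, where $\Theta\subset\mathbb R$ is an interval and $b(\theta)=\ln\int_{\mathbb R}e^{x\theta}m(dx)$. Members are determined by their mean $b'(\theta)$. $\mathrm{KL}(\mu,\mu')$ denotes the Kullback–Leibler divergence $\mathbb E_{X\sim\nu}[\ln\frac{d\nu}{d\nu'}(X)]$ between the members $\nu,\nu'$ of $\mathcal F_m$ with means $\mu,\mu'$. Bandit: each arm $a\in[K]=\{1,\dots,K\}$ has reward distribution $\nu_a\in\mathcal F_m$ with mean $\mu_a$; $\mu_{\max}=\max_a\mu_a$. In round $t=1,2,\dots$ the agent picks $I_t\in[K]$ (based on the past and internal randomness) and receives $r_t\sim\nu_{I_t}$, independent of the past given $I_t$. $N_{t,a}=\sum_{i\le t}\mathbf 1\{I_i=a\}$, $\hat\mu_{t,a}=\frac1{N_{t,a}}\sum_{i\le t}r_i\mathbf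 1\{I_i=a\}$, $\hat\mu_{t,\max}=\max_a\hat\mu_{t,a}$. It is assumed that empirical means are means of members of $\mathcal F_m$. Regret: $\mathrm{Reg}(T)=\mathbb E\big[\sum_{t=1}^T(\mu_{\max}-\mu_{I_t})\big]$. Exp-KL-MS: in rounds $t\le K$ pull $I_t=t$; in each round $t>K$ pull $I_t=a$ with probability $p_{t,a}=\exp\!\big(-L(N_{t-1,a})\,\mathrm{KL}(\hat\mu_{t-1,a},\hat\mu_{t-1,\max})\big)/M_t$, where $L(k)=k-1$ and $M_t$ normalizes the probabilities to sum to $1$. *)

(* Defs.v *)
From HB Require Import structures.
From mathcomp Require Import all_boot all_order all_algebra.
From mathcomp Require Import all_classical all_reals all_analysis.
Import Order.TTheory GRing.Theory Num.Theory.
Import numFieldNormedType.Exports.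

Set Implicit Arguments.
Unset Strict Implicit.
Unset Printing Implicit Defensive.

Local Open Scope classical_set_scope.
Local Open Scope ring_scope.
Local Open Scope charge_scope.

(* Derivative of f at x relative to A: one-sided when A is an interval and x
   one of its endpoints, the usual derivative when x is interior to A. *)
Definition is_derive_in (R : realType) (A : set R) (f : R -> R) (x l : R) :=
  (f y - f x) / (y - x) @[y --> within A x^'] --> l.

Section exponential_family.
Context {R : realType}.
Implicit Types (m : {measure set (measurableTypeR R) -> \bar R}) (Theta : set R).
Local Notation law := (probability (measurableTypeR R) R).

(* The integral defining exp (b theta), as an extended real; the definition of
   log_partition is meaningful only when it lies in ]0, +oo[. *)
Definition laplace m (theta : R) : \bar R :=
  (\int[m]_x (expR (x * theta))%:E)%E.

Definition log_partition m (theta : R) : R := ln (fine (laplace m theta)).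

Definition expfam m Theta : set law :=
  [set nu | exists2 theta, Theta theta &
    forall A, measurable A ->
      nu A = (\int[m]_(x in A) (expR (x * theta - log_partition m theta))%:E)%E].

Definition mean (nu : law) : \bar R := 'E_nu[idfun].

Definition KLdiv (nu nu' : law) : \bar R :=
  if `[< nu `<< nu' >]
  then (\int[nu]_x lne (('d (charge_of_finite_measure nu) '/d nu') x))%E
  else +oo%E.

(* A member of F with mean mu, or an arbitrary law if there is none. *)
Definition member_of_mean (F : set law) (mu : R) : law :=
  get [set nu | F nu /\ mean nu = mu%:E].

Definition KL (F : set law) (mu mu' : R) : R :=
  fine (KLdiv (member_of_mean F mu) (member_of_mean F mu')).

End exponential_family.

(* Arms are numbered from 0: the k-th arm, 1 <= k <= K, is the ordinal k.-1. *)
Definition max_arm (R : realType) (K : nat) (f : 'I_K -> R) : R := sup (range f).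

(* I t and r t are the arm and the reward of round t = 1, 2, ...;
   I 0 and r 0 are never used. *)
Section bandit.
Context {R : realType} {d : measure_display} {Omega : measurableType d}.
Variables (P : probability Omega R) (K : nat).
Variables (I : nat -> Omega -> 'I_K) (r : nat -> {RV P >-> R}).
Local Notation law := (probability (measurableTypeR R) R).

Definition pulls (t : nat) (a : 'I_K) (w : Omega) : nat :=
  (\sum_(1 <= i < t.+1) (I i w == a))%N.

Definition emp_mean (t : nat) (a : 'I_K) (w : Omega) : R :=
  (\sum_(1 <= i < t.+1 | I i w == a) r i w) / (pulls t a w)%:R.

Definition emp_max (t : nat) (w : Omega) : R :=
  max_arm (fun a => emp_mean t a w).

(* sigma(I 1, r 1, ..., I t, r t) *)
Definition history (t : nat) : set (set Omega) :=
  <<s [set E | exists2 i, (1 <= i <= t)%N &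
         (exists a, E = I i @^-1` [set a]) \/
         (exists2 B : set (measurableTypeR R), measurable B & E = r i @^-1` B)] >>.

(* Conditionally on the history of the first t rounds and on I t.+1 = a, the
   reward r t.+1 has law nu a. *)
Definition bandit_rewards (nu : 'I_K -> law) : Prop :=
  forall (t : nat) (E : set Omega) (a : 'I_K) (B : set (measurableTypeR R)),
    history t E -> measurable B ->
    P (E `&` I t.+1 @^-1` [set a] `&` r t.+1 @^-1` B) =
    (P (E `&` I t.+1 @^-1` [set a]) * nu a B)%E.

(* p t a is the conditional probability of I t = a given the history of the
   first t - 1 rounds. *)
Definition follows_policy (p : nat -> 'I_K -> Omega -> R) : Prop :=
  forall (t : nat) (E : set Omega) (a : 'I_K), history t E ->
    P (E `&` I t.+1 @^-1` [set a]) = (\int[P]_(w in E) (p t.+1 a w)%:E)%E.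

Definition regret (mu : 'I_K -> R) (T : nat) : \bar R :=
  'E_P[fun w => \sum_(1 <= t < T.+1) (max_arm mu - mu (I t w))].

Definition expklms_weight (F : set law) (t : nat) (a : 'I_K) (w : Omega) : R :=
  expR (- (((pulls t.-1 a w)%:R - 1) *
           KL F (emp_mean t.-1 a w) (emp_max t.-1 w))).

Definition expklms (F : set law) (t : nat) (a : 'I_K) (w : Omega) : R :=
  if (t <= K)%N then (t == a.+1)%:R
  else expklms_weight F t a w / \sum_(c < K) expklms_weight F t c w.

End bandit.

(* Main.v *)
(* Write [D u v] for the Kullback-Leibler divergence between the members of
   parameters [u] and [v]: it is the Bregman divergence of the log-partition
   function, and Chernoff's bound for the first [k] rewards of an arm of
   parameter [u] has exponent [k * D v u].  Let [a] be a suboptimal arm and [a1]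
   an optimal one, of parameters [u < u1].

   Upper bound.  Take [u < x < y < u1].  The pulls of [a] are of four kinds: the
   first [n ~ ln T / D x y]; those where the empirical mean of [a] exceeds that
   of [x], a geometric series by Chernoff; those after the [n]-th pull where it
   does not while some empirical mean exceeds that of [y], which occur at each
   round with probability at most [exp (- n * D x y) <= 1 / T]; and those where
   all the empirical means are below that of [y].  For the last ones, [a] is
   pulled at most [exp ((k - 1) * D q y)] times as often as [a1] when the [k]
   first rewards of [a1] have an empirical mean of parameter [q < y], and
   Chernoff gives [exp (- k * (D q y + D y u1))] to this event: the sum over the
   levels of [D q y] and over [k] is finite.

   Lower bound.  Take [x <= u < u1 <= z] and [n ~ (1 - eps) * ln T / D x z].  As
   long as [a] has been pulled at most [n] times and no empirical mean leaves the
   range given by [x] and [z], the arm [a] is pulled with probability at least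
   [exp (- n * D x z) / K = T ^ (eps - 1) / K], so that the expected number of
   such rounds is [o(T)]; the other rounds on which [a] has been pulled at most
   [n] times are at most [delta * T] in expectation, and hence [a] is pulled more
   than [n] times with probability close to [1].

   Then let [D x y] and [D x z] tend to [D u u1]. *)
Require Import Defs.
From HB Require Import structures.
From mathcomp Require Import all_boot all_order all_algebra.
From mathcomp Require Import all_classical all_reals all_analysis.
From mathcomp Require Import measurable_realfun simple_functions.
From mathcomp Require Import measurable_fun_approximation ring lra zify.
Import Order.TTheory GRing.Theory Num.Theory.
Import numFieldNormedType.Exports.

Set Implicit Arguments.
Unset Strict Implicit.
Unset Printing Implicit Defensive.

Local Open Scope classical_set_scope.
Local Open Scope ring_scope.

(** * Convex potentials and Bregman divergences *)

(** Since [A] contains a right neighbourhood of [x], the limit within [A] restricts to the limit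
    from the right, where the difference quotient is the constant [c]. An endpoint of the interval
    and an interior point are thus treated alike. *)
Lemma is_derive_in_affine {R : realType} (A : set R) (f : R -> R) (x l c y0 : R) :
  x < y0 -> (forall y, x < y < y0 -> A y /\ f y - f x = c * (y - x)) ->
  is_derive_in A f x l -> l = c.
Proof.
move=> xy0 H fl.
have {}fl : (f y - f x) / (y - x) @[y --> x^'+] --> l.
  apply: cvg_trans fl; apply: cvg_app.
  move=> U /= [e e0 xeU]; exists (Num.min e (y0 - x)).
    by rewrite /= lt_min e0 subr_gt0.
  move=> y /=; rewrite lt_min => /andP[xye xyy] xy.
  apply: xeU => //=; first by rewrite gt_eqF.
  apply: (H y _).1; rewrite xy/=.
  by move: xyy; rewrite distrC gtr0_norm ?subr_gt0// ltrD2r.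
have fc : (f y - f x) / (y - x) @[y --> x^'+] --> c.
  apply: (@cvg_trans _ (cst c @ x^'+)); last exact: cvg_cst.
  apply: near_eq_cvg; near=> y; rewrite (H y _).2 ?mulfK// ?subr_eq0 ?gt_eqF//.
  by apply/andP; split; near: y; [exact: nbhs_right_gt|exact: nbhs_right_lt].
by rewrite -(cvg_lim (@Rhausdorff R) fl) (cvg_lim (@Rhausdorff R) fc).
Unshelve. all: by end_near. Qed.

Section convex_family.
Context {R : realType}.
Variables (Theta : set R) (b M : R -> R).

(** [M] stands for the slope of [b], but only as a subgradient, through [tangent]; the endpoints of
    [Theta] then need no special treatment. *)
Definition bregman (u v : R) : R := M u * (u - v) - b u + b v.
Local Notation D := bregman.

Hypothesis itv : is_interval Theta.
Hypothesis tangent : forall u v, Theta u -> Theta v -> b u + M u * (v - u) <= b v.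

Lemma between u v w : Theta u -> Theta v -> u <= w -> w <= v -> Theta w.
Proof. by move=> Tu Tv uw wv; apply: (itv Tu Tv); rewrite uw. Qed.

(** Adding the tangent inequalities at [u] and at [v] gives [0 <= (M v - M u) * (v - u)]. *)
Lemma mean_le u v : Theta u -> Theta v -> u <= v -> M u <= M v.
Proof.
move=> Tu Tv; rewrite le_eqVlt => /predU1P[->//|uv].
rewrite -(ler_pM2r (_ : 0 < v - u)) ?subr_gt0//.
have := tangent Tu Tv; have := tangent Tv Tu; lra.
Qed.

Lemma bregman_ge0 u v : Theta u -> Theta v -> 0 <= D u v.
Proof. by move=> Tu Tv; have := tangent Tu Tv; rewrite /bregman; lra. Qed.

Lemma bregmanxx u : D u u = 0.
Proof. by rewrite /bregman; ring. Qed.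

(** The three-point identity. When [w] lies between [u] and [v], its last term is nonnegative by
    monotonicity of [M]; the comparisons of divergences below all rest on this sign. *)
Lemma bregman_split u w v : D u v = D u w + D w v + (M w - M u) * (v - w).
Proof. by rewrite /bregman; ring. Qed.

Lemma bregman_sym u v : D u v + D v u = (M v - M u) * (v - u).
Proof. by rewrite /bregman; ring. Qed.

Lemma bregman_leM u v : Theta u -> Theta v -> D u v <= (M v - M u) * (v - u).
Proof. by move=> Tu Tv; rewrite -bregman_sym lerDl bregman_ge0. Qed.

(** If [M u = M v], then [M] is constant on [[u, v]], so [b] is affine there, [b'] is constant on
    [[u, v[] and [b'' u = 0], against positivity. *)
Lemma mean_lt (b' b'' : R -> R) u v :
  (forall t, Theta t -> is_derive_in Theta b t (b' t)) ->
  (forall t, Theta t -> is_derive_in Theta b' t (b'' t)) ->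
  (forall t, Theta t -> 0 < b'' t) ->
  Theta u -> Theta v -> u < v -> M u < M v.
Proof.
move=> hb' hb'' hb''_pos Tu Tv uv; rewrite lt_neqAle mean_le ?ltW// andbT.
apply/eqP => eM.
have inT w : u <= w <= v -> Theta w by move=> /andP[]; exact: between.
have bE w : u <= w <= v -> b w = b u + M u * (w - u).
  move=> wI; have Tw := inT _ wI; move: wI => /andP[w1 w2].
  have Mw : M w = M u.
    by apply/eqP; rewrite eq_le [M u <= _]mean_le// eM mean_le.
  by have := tangent Tu Tw; have := tangent Tw Tu; rewrite Mw; lra.
have b'E w : u <= w < v -> b' w = M u.
  move=> /andP[w1 w2]; have wI : u <= w <= v by rewrite w1 ltW.
  apply: (is_derive_in_affine w2 _ (hb' _ (inT _ wI))) => y /andP[y1 y2].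
  have yI : u <= y <= v by rewrite (le_trans w1 (ltW y1)) ltW.
  by split; [exact: inT|rewrite (bE y)// (bE w)//; ring].
suff : b'' u = 0 by move=> e; have := hb''_pos _ Tu; rewrite e ltxx.
apply: (is_derive_in_affine uv _ (hb'' _ Tu)) => y /andP[y1 y2].
have yI : u <= y <= v by rewrite !ltW.
by split; [exact: inT|rewrite !b'E ?lexx ?uv// ?(ltW y1)//; ring].
Qed.

Lemma bregman_monol u w v : Theta u -> Theta w -> Theta v ->
  u <= w <= v \/ v <= w <= u -> D w v <= D u v.
Proof.
move=> Tu Tw Tv H; rewrite [leRHS](bregman_split u w v).
have := bregman_ge0 Tu Tw.
case: H => /andP[h1 h2].
  have := mean_le Tu Tw h1; nra.
have := mean_le Tw Tu h2; nra.
Qed.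

Lemma bregman_monor u w v : Theta u -> Theta w -> Theta v ->
  u <= w <= v \/ v <= w <= u -> D u w <= D u v.
Proof.
move=> Tu Tw Tv H; rewrite [leRHS](bregman_split u w v).
have := bregman_ge0 Tw Tv.
case: H => /andP[h1 h2].
  have := mean_le Tu Tw h1; nra.
have := mean_le Tw Tu h2; nra.
Qed.

(** For points in order on the line the triangle inequality is reversed, because the cross term of
    [bregman_split] is nonnegative. *)
Lemma bregman_triangle u w v : Theta u -> Theta w -> Theta v ->
  u <= w <= v \/ v <= w <= u -> D u w + D w v <= D u v.
Proof.
move=> Tu Tw Tv H; rewrite (bregman_split u w v).
case: H => /andP[h1 h2].
  have := mean_le Tu Tw h1; nra.
have := mean_le Tw Tu h2; nra.
Qed.

(** All the subgradients on the segment lie between [M u] and [M v], so [b] is Lipschitz along it,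
    even up to an endpoint of [Theta]. *)
Lemma potential_segment u v h : Theta u -> Theta v -> 0 < h <= 1 ->
  Theta (u + h * (v - u)) /\
  `|b (u + h * (v - u)) - b u| <= (`|M u| + `|M v|) * `|v - u| * h.
Proof.
move=> Tu Tv /andP[h0 h1]; set t := u + _.
have [Tt Mt] : Theta t /\ `|M t| <= `|M u| + `|M v|.
  have := ler_norm (M u); have := ler_norm (M v).
  have := lerNnormlW (lexx `|M u|); have := lerNnormlW (lexx `|M v|).
  rewrite [`|M t| <= _]ler_norml.
  have [le|/ltW le] := leP u v.
    have t1 : u <= t by rewrite /t; nra.
    have t2 : t <= v by rewrite /t; nra.
    have Tt := between Tu Tv t1 t2.
    by have := mean_le Tu Tt t1; have := mean_le Tt Tv t2; split => //; lra.
  have t1 : v <= t by rewrite /t; nra.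
  have t2 : t <= u by rewrite /t; nra.
  have Tt := between Tv Tu t1 t2.
  by have := mean_le Tv Tt t1; have := mean_le Tt Tu t2; split => //; lra.
split => //; have tE : t - u = h * (v - u) by rewrite /t addrC addKr.
have := tangent Tu Tt; have := tangent Tt Tu.
rewrite -(opprB t u) tE => h2 h3.
have hs : `|h * (v - u)| = `|v - u| * h by rewrite normrM mulrC (gtr0_norm h0).
have B1 : `|M u * (h * (v - u))| <= (`|M u| + `|M v|) * `|v - u| * h.
  by rewrite normrM hs -mulrA ler_wpM2r ?mulr_ge0 ?(ltW h0)// lerDl.
have B2 : `|M t * (h * (v - u))| <= (`|M u| + `|M v|) * `|v - u| * h.
  by rewrite normrM hs -mulrA ler_wpM2r ?mulr_ge0 ?(ltW h0).
move: B1 B2; rewrite !ler_norml => /andP[B1 _] /andP[_ B2].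
by apply/andP; split; lra.
Qed.

Hypothesis strict : forall u v, Theta u -> Theta v -> u < v -> M u < M v.
(** One-sided continuity of [M] at [u], in a weak form: one point of the segment is enough, since
    [M] is monotone and hence at least as close to [M u] at all the points before it. *)
Hypothesis near_mean : forall u v, Theta u -> Theta v -> forall e : R, 0 < e ->
  exists k : R, 0 < k <= 1 /\ `|M (u + k * (v - u)) - M u| < e.

Lemma mean_leE u v : Theta u -> Theta v -> (M u <= M v) = (u <= v).
Proof.
move=> Tu Tv; apply/idP/idP; last exact: mean_le.
by apply: contraTT; rewrite -!ltNge; exact: strict.
Qed.

Lemma mean_inj u v : Theta u -> Theta v -> M u = M v -> u = v.
Proof. by move=> Tu Tv e; apply/eqP; rewrite eq_le -(mean_leE Tu Tv) -(mean_leE Tv Tu) e lexx.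
  Qed.

(** Splitting at the midpoint leaves a cross term that is positive by strict monotonicity of [M]. *)
Lemma bregman_gt0 u v : Theta u -> Theta v -> u != v -> 0 < D u v.
Proof.
move=> Tu Tv uv; pose w := (u + v) / 2.
have [Tw mM] : Theta w /\ 0 < (M w - M u) * (v - w).
  move: uv; rewrite neq_lt => /orP[uv|vu].
    have Tw : Theta w by apply: (between Tu Tv); rewrite /w; lra.
    split=> //; apply: mulr_gt0; last by rewrite /w; lra.
    by rewrite subr_gt0 strict// /w; lra.
  have Tw : Theta w by apply: (between Tv Tu); rewrite /w; lra.
  split=> //; rewrite -mulrNN; apply: mulr_gt0; last by rewrite /w; lra.
  by rewrite oppr_gt0 subr_lt0 strict// /w; lra.
rewrite (bregman_split u w v) ltr_wpDl// addr_ge0//; exact: bregman_ge0.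
Qed.

Lemma near_right u v e : Theta u -> Theta v -> u < v -> 0 < e ->
  exists w, [/\ Theta w, u < w <= v & M w < M u + e].
Proof.
move=> Tu Tv uv e0; have [k [/andP[k0 k1]]] := near_mean Tu Tv e0.
set w := u + _ => h.
have w1 : u < w by rewrite /w ltrDl mulr_gt0// subr_gt0.
have w2 : w <= v by rewrite /w; nra.
exists w; split; rewrite ?w1//; first exact: (between Tu Tv (ltW w1) w2).
by move: h; rewrite ltr_norml; lra.
Qed.

Lemma near_left u v e : Theta u -> Theta v -> v < u -> 0 < e ->
  exists w, [/\ Theta w, v <= w < u & M u < M w + e].
Proof.
move=> Tu Tv uv e0; have [k [/andP[k0 k1]]] := near_mean Tu Tv e0.
set w := u + _ => h.
have w1 : w < u by rewrite /w; nra.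
have w2 : v <= w by rewrite /w; nra.
exists w; split; rewrite ?w2//; first exact: (between Tv Tu w2 (ltW w1)).
by move: h; rewrite ltr_norml; lra.
Qed.

(** The cost of widening [[u, v]] to [[x, y]]. The first error is small once [M x] is close to
    [M u], the second once [y] is close to [v]: the left end is adjusted through [near_mean], the
    right end through its distance. *)
Lemma bregman_widen_le x u v y : Theta x -> Theta u -> Theta v -> Theta y ->
  x <= u -> u <= v -> v <= y ->
  D x y <= D u v + (M u - M x) * (y - x) + (M y - M x) * (y - v).
Proof.
move=> Tx Tu Tv Ty xu uv vy.
rewrite (bregman_split x u y) (bregman_split u v y).
have := bregman_leM Tx Tu; have := bregman_leM Tv Ty.
have : 0 <= (M u - M x) * (y - v).
  by rewrite mulr_ge0 ?subr_ge0// mean_le.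
lra.
Qed.

Lemma bregman_inner u v e : Theta u -> Theta v -> u < v -> 0 < e ->
  exists x y, [/\ Theta x, Theta y, u < x < y, y < v & D u v - e <= D x y].
Proof.
move=> Tu Tv uv e0; pose w := (u + v) / 2.
have Tw : Theta w by apply: (between Tu Tv); rewrite /w; lra.
have uw : u < w by rewrite /w; lra.
pose e1 := e / 2 / (v - u).
have e10 : 0 < e1 by rewrite divr_gt0 ?subr_gt0// divr_gt0.
have [x [Tx /andP[ux xw] Mx]] := near_right Tu Tw uw e10.
have Muv : 0 < M v - M u by rewrite subr_gt0 strict.
(* The first bound keeps [v - c] to the right of the midpoint [w], hence of [x]; the second makes
   the error due to the right end at most [e / 2]. *)
pose c := Num.min ((v - u) / 4) (e / 2 / (M v - M u)).
have c0 : 0 < c.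
  by rewrite lt_min !divr_gt0// subr_gt0.
have c1 : c <= (v - u) / 4 by rewrite ge_min lexx.
have c2 : (M v - M u) * c <= e / 2.
  by rewrite mulrC -ler_pdivlMr// ge_min lexx orbT.
have c3 : (v - u) * (M x - M u) <= e / 2.
  rewrite mulrC -ler_pdivlMr ?subr_gt0// -/e1; lra.
have Ty : Theta (v - c) by apply: (between Tu Tv); lra.
exists x, (v - c); split => //.
- by rewrite ux/=; apply: (le_lt_trans xw); rewrite /w; lra.
- by lra.
have xy : x <= v - c by apply: (le_trans xw); rewrite /w; lra.
have := bregman_widen_le Tu Tx Ty Tv (ltW ux) xy (_ : v - c <= v).
rewrite opprB addrCA subrr addr0; lra.
Qed.

(** At an endpoint of [Theta] there is no room to move outwards; the second alternatives record this
    case, in which no mean of the family lies beyond. *)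
Lemma bregman_outer u v e : Theta u -> Theta v -> u < v -> 0 < e ->
  exists x y, [/\ Theta x, Theta y, x <= u /\ v <= y,
    (x < u \/ forall w, Theta w -> u <= w) /\
    (v < y \/ forall w, Theta w -> w <= v) & D x y <= D u v + e].
Proof.
move=> Tu Tv uv e0.
have [x [Tx xu xu']] : exists x, [/\ Theta x, x <= u &
    x < u \/ forall w, Theta w -> u <= w].
  case: (pselect (exists2 w, Theta w & w < u)) => [[w Tw wu]|H].
    by exists w; split=> //; [exact: ltW|left].
  exists u; split=> //; right => w Tw; rewrite leNgt; apply/negP => wu.
  by apply: H; exists w.
have [y [Ty vy yv']] : exists y, [/\ Theta y, v <= y &
    v < y \/ forall w, Theta w -> w <= v].
  case: (pselect (exists2 w, Theta w & v < w)) => [[w Tw wu]|H].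
    by exists w; split=> //; [exact: ltW|left].
  exists v; split=> //; right => w Tw; rewrite leNgt; apply/negP => wu.
  by apply: H; exists w.
have xy : 0 < y - x by lra.
have Mxy : 0 < M y - M x by rewrite subr_gt0 strict//; lra.
(* The first [x] and [y] only fix the scales [y - x] and [M y - M x]. The final points are taken in
   [[x, u]] and [[v, y]], close enough to [u] and [v] for each error to be at most [e / 2]. *)
have [x1 [Tx1 /andP[xx1 x1u] x1u' Mx1]] : exists x1, [/\ Theta x1, x <= x1 <= u,
    x1 < u \/ (forall w, Theta w -> u <= w) & M u - M x1 <= e / 2 / (y - x)].
  case: xu' => [xu'|H]; last first.
    exists u; split=> //; [by rewrite lexx xu|by right|].
    by rewrite subrr !divr_ge0// ltW.
  have [|w [Tw /andP[xw wu] Mw]] := @near_left u x (e / 2 / (y - x)) Tu Tx xu'.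
    by rewrite !divr_gt0.
  exists w; split=> //; [by rewrite xw ltW|by left|lra].
pose c := e / 2 / (M y - M x); have c0 : 0 < c by rewrite !divr_gt0.
pose y1 := Num.min y (v + c).
have y1y : y1 <= y by rewrite ge_min lexx.
have y1v : v <= y1 by rewrite le_min vy lerDl ltW.
have y1c : y1 <= v + c by rewrite ge_min lexx orbT.
have Ty1 : Theta y1 by exact: (between Tv Ty).
exists x1, y1; split=> //.
  split=> //; case: yv' => [vy'|]; last by right.
  by left; rewrite lt_min vy' ltrDl.
have := bregman_widen_le Tx1 Tu Tv Ty1 x1u (ltW uv) y1v.
have h1 : (M u - M x1) * (y1 - x1) <= e / 2.
  apply: (@le_trans _ _ (e / 2 / (y - x) * (y - x))); last by rewrite divfK ?gt_eqF.
  apply: ler_pM => //; [|lra|lra].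
  by rewrite subr_ge0 mean_le.
have h2 : (M y1 - M x1) * (y1 - v) <= e / 2.
  apply: (@le_trans _ _ ((M y - M x) * c)); last by rewrite mulrC divfK ?gt_eqF.
  apply: ler_pM; [|lra| |lra].
    by rewrite subr_ge0 mean_le//; lra.
  by rewrite lerB// mean_le.
lra.
Qed.

(** Left of [y], the parameters at divergence at least [s] from [y] form an initial segment that
    contains its supremum. A condition on the divergence thus becomes a half-line for the empirical
    mean, to which Chernoff's bound applies. *)
Lemma bregman_level y s : Theta y ->
  (forall u, Theta u -> u <= y -> D u y < s) \/
  exists u, [/\ Theta u, u <= y, s <= D u y &
    forall w, Theta w -> w <= y -> s <= D w y -> w <= u].
Proof.
move=> Ty; case: (pselect (exists u, [/\ Theta u, u <= y & s <= D u y])) => [|H]; last first.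
  left => u Tu uy; rewrite ltNge; apply/negP => h; apply: H.
  by exists u.
move=> [u0 [Tu0 u0y su0]]; right.
pose S := [set u | [/\ Theta u, u <= y & s <= D u y]].
have S0 : S u0 by [].
have Sub : ubound S y by move=> u [].
have Ssup : has_sup S by split; [exists u0|exists y].
pose u := sup S.
have uy : u <= y by apply: ge_sup => //; exists u0.
have Su w : S w -> w <= u by move=> Sw; apply: ub_le_sup => //; exists y.
have Tu : Theta u by apply: (between Tu0 Ty) => //; exact: Su.
exists u; split=> //; last by move=> w Tw wy sw; apply: Su.
(* If the supremum is not attained by a member of [S] known in advance, some [v] in [S] just below
   it has [M v] close to [M u], which yields [s <= D u y + e] for every positive [e]. *)
case: (pselect (S u)) => [[]//|nSu].
have u0u : u0 < u by rewrite lt_neqAle Su// andbT; apply/eqP => e; apply: nSu; rewrite -e.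
apply/ler_addgt0Pr => e e0.
have d0 : 0 < y - u0 by lra.
have [|w [Tw /andP[w1 w2] Mw]] := @near_left u u0 (e / (y - u0)) Tu Tu0 u0u.
  by rewrite divr_gt0.
have [v Sv wv] := sup_gt (ex_intro _ _ S0) w2.
have [Tv vy sv] := Sv; have vu := Su _ Sv.
apply: (le_trans sv); rewrite (bregman_split v u y).
have := bregman_leM Tv Tu.
have h : (M u - M v) * (y - v) <= e.
  apply: (@le_trans _ _ (e / (y - u0) * (y - u0))); last by rewrite divfK ?gt_eqF.
  apply: ler_pM; [|lra| |].
  - by rewrite subr_ge0 mean_le.
  - by have := mean_le Tw Tv (ltW wv); lra.
  - lra.
lra.
Qed.

End convex_family.

(** * One-parameter exponential families *)

Section integral_density.
Local Open Scope ereal_scope.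
Context {d} {T : measurableType d} {R : realType}.
Variables (mu nu : {measure set T -> \bar R}) (h : T -> R).
Hypothesis mh : measurable_fun setT h.
Hypothesis h0 : forall x, (0 <= h x)%R.
Hypothesis nuE : forall A, measurable A -> nu A = \int[mu]_(x in A) (h x)%:E.
Import HBNNSimple.

Let mhE : measurable_fun setT (EFin \o h).
Proof. exact/measurable_EFinP. Qed.

Let nnsfun_density (s : {nnsfun T >-> R}) :
  \int[nu]_x (s x)%:E = \int[mu]_x (s x * h x)%:E.
Proof.
have ms y : measurable (s @^-1` [set y]) by exact: measurable_funPTI.
have s0 y : range s y -> (0 <= y)%R by case=> x _ <-.
have mi y : measurable_fun setT (fun x => (\1_(s @^-1` [set y]) x * h x)%:E).
  by apply/measurable_EFinP; apply: measurable_funM => //; exact: measurable_indic.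
transitivity (\sum_(y \in range s) y%:E * nu (s @^-1` [set y])).
  by rewrite integral_nnsfun// patch_setT sintegralE.
transitivity (\int[mu]_x \sum_(y \in range s) y%:E * (\1_(s @^-1` [set y]) x * h x)%:E).
  rewrite ge0_integral_fsum//; last 2 first.
  - by move=> y; apply: emeasurable_funM.
  - move=> y x _; have [/s0 y0|ny] := pselect (range s y).
      by rewrite mule_ge0 ?lee_fin// mulr_ge0.
    by rewrite indicE memNset ?mul0r ?mule0//= => e; apply: ny; exists x.
  apply: eq_fsbigr => y /set_mem/s0 y0.
  rewrite ge0_integralZl ?lee_fin//; last by move=> x _; rewrite lee_fin mulr_ge0.
  congr (_ * _); rewrite nuE// integral_mkcond; apply: eq_integral => x _.
  by rewrite epatch_indic -EFinM mulrC.
apply: eq_integral => x _; rewrite [in RHS](fimfunE s x) EFinM -fsumEFin//.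
rewrite ge0_mule_fsuml => [|y]; last exact: nnfun_muleindic_ge0.
by apply: eq_fsbigr => y _; rewrite -!EFinM mulrA.
Qed.

Let ge0_integral_density_setT (f : T -> \bar R) : measurable_fun setT f ->
  (forall x, 0 <= f x) -> \int[nu]_x f x = \int[mu]_x (f x * (h x)%:E).
Proof.
move=> mf f0; pose g := nnsfun_approx measurableT mf.
have gf x : (g n x)%:E @[n --> \oo] --> f x by apply: cvg_nnsfun_approx.
have nd x : nondecreasing_seq (fun n => (g n x)%:E).
  by move=> i j ij; rewrite lee_fin; exact/lefP/nd_nnsfun_approx.
have nuf : \int[nu]_x (g n x)%:E @[n --> \oo] --> \int[nu]_x f x.
  rewrite (_ : f = fun x => limn (fun n => (g n x)%:E)); last first.
    by apply/funext => x; apply/esym/cvg_lim.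
  apply: cvg_monotone_convergence => //.
  - by move=> n; exact/measurable_EFinP.
  - by move=> n x _; rewrite lee_fin.
suff muf : \int[nu]_x (g n x)%:E @[n --> \oo] --> \int[mu]_x (f x * (h x)%:E).
  exact: (cvg_unique _ nuf muf).
under eq_fun do rewrite nnsfun_density.
rewrite (_ : (fun x => f x * _) = fun x => limn (fun n => (g n x * h x)%:E)); last first.
  apply/funext => x; apply/esym/cvg_lim => //; under eq_fun do rewrite EFinM.
  by apply: cvgeZr => //; exact: gf.
apply: cvg_monotone_convergence => //.
- by move=> n; apply/measurable_EFinP; exact: measurable_funM.
- by move=> n x _; rewrite lee_fin mulr_ge0.
- by move=> x _ i j ij; rewrite !EFinM lee_wpmul2r ?lee_fin//; exact: nd.
Qed.

Lemma ge0_integral_density (f : T -> \bar R) (D : set T) : measurable D ->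
  measurable_fun D f -> (forall x, D x -> 0 <= f x) ->
  \int[nu]_(x in D) f x = \int[mu]_(x in D) (f x * (h x)%:E).
Proof.
move=> mD mf f0; rewrite integral_mkcond ge0_integral_density_setT; last 2 first.
- exact/(measurable_restrictT _ _).1.
- exact/erestrict_ge0.
rewrite [RHS]integral_mkcond; apply: eq_integral => x _.
by rewrite !patchE; case: ifP; rewrite ?mul0e.
Qed.

Lemma integrable_densityr (f : T -> R) : measurable_fun setT f ->
  nu.-integrable setT (EFin \o f) -> mu.-integrable setT (fun x => (f x * h x)%:E).
Proof.
move=> mf /integrableP[_ fh]; apply/integrableP; split.
  by apply/measurable_EFinP; exact: measurable_funM.
move: fh; rewrite ge0_integral_density//; last first.
  by apply: measurableT_comp => //; exact/measurable_EFinP.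
under eq_integral => x _ do rewrite -[(h x)%:E]gee0_abs ?lee_fin// -abseM.
by [].
Qed.

Lemma integral_density (f : T -> R) : measurable_fun setT f ->
  \int[nu]_x (f x)%:E = \int[mu]_x (f x * h x)%:E.
Proof.
move=> mf; rewrite integralE [RHS]integralE.
have mfE : measurable_fun setT (EFin \o f) by exact/measurable_EFinP.
rewrite !ge0_integral_density//; last 2 first.
  exact: measurable_funeneg.
  exact: measurable_funepos.
congr (_ - _); apply: eq_integral => x _ /=.
- by rewrite !funeposE maxe_pMl ?lee_fin// mul0e.
- by rewrite !funenegE maxe_pMl ?lee_fin// mul0e EFinM mulNe.
Qed.
End integral_density.

Lemma density_measure {d} {T : measurableType d} {R : realType}
    (mu : {measure set T -> \bar R}) (h : T -> R) :
  measurable_fun setT h -> (forall x, 0 <= h x) ->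
  exists rho : {measure set T -> \bar R}, forall A, measurable A ->
    rho A = (\int[mu]_(x in A) (h x)%:E)%E.
Proof.
move=> mh h0; pose rho (A : set T) := (\int[mu]_(x in A) (h x)%:E)%E.
have rho0 : rho set0 = 0%E by rewrite /rho integral_set0.
have rho_ge0 A : (0 <= rho A)%E.
  by apply: integral_ge0 => x _; rewrite lee_fin.
have rho_sa : semi_sigma_additive rho.
  move=> F mF tF mUF; rewrite /rho; apply: cvg_toP.
    apply: ereal_nondecreasing_is_cvgn => i j ij.
    by apply: lee_sum_nneg_natr => // k _ _; exact: rho_ge0.
  rewrite ge0_integral_bigcup//.
  - exact/measurable_funTS/measurable_EFinP.
  - by move=> x _; rewrite lee_fin.
have rhoM := isMeasure.Build _ _ _ rho rho0 rho_ge0 rho_sa.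
by exists (HB.pack_for {measure set T -> \bar R} rho rhoM).
Qed.

Lemma density_probability {d} {T : measurableType d} {R : realType}
    (mu : {measure set T -> \bar R}) (h : T -> R) :
  measurable_fun setT h -> (forall x, 0 <= h x) ->
  (\int[mu]_x (h x)%:E = 1)%E ->
  exists rho : probability T R, forall A, measurable A ->
    rho A = (\int[mu]_(x in A) (h x)%:E)%E.
Proof.
move=> mh h0 h1; have [[rho c] rhoE] := density_measure mu mh h0.
have rho1 : Measure.Pack c setT = 1%E by rewrite rhoE.
pose rhoP := Measure_isProbability.Build _ _ _ (Measure.Pack c) rho1.
by exists (HB.pack_for (probability T R) rho (Measure.Pack c) rhoP).
Qed.

Lemma measurable_lne_EFin {d} {T : measurableType d} {R : realType} (f : T -> R) :
  measurable_fun setT f -> measurable_fun setT (fun x => lne (f x)%:E).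
Proof.
move=> mf; apply: measurable_fun_ifT => //.
  exact: measurable_fun_ler.
by apply/measurable_EFinP; exact: measurableT_comp.
Qed.

(** From [exp (h * x * s) <= 1 + exp (x * s)] when [0 < h <= 1]. The bound is uniform in [h] and
    serves as the dominating function in [param_mean_near]. *)
Lemma tilt_bound {R : realType} (x s h c C B : R) : 0 < h <= 1 -> `|c| <= C ->
  (`|(x * expR (x * (h * s) - c))%:E| <=
   (expR C)%:E * (`|x%:E| + (expR B)%:E * `|(x * expR (x * s - B))%:E|))%E.
Proof.
move=> /andP[h0 h1]; rewrite ler_norml => /andP[cC _].
suff : `|x * expR (x * (h * s) - c)| <= expR C * (`|x| + expR B * `|x * expR (x * s - B)|).
  by rewrite -lee_fin.
rewrite !normrM !(gtr0_norm (expR_gt0 _)).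
have E : expR B * expR (x * s - B) = expR (x * s).
  by rewrite -expRD; congr expR; ring.
rewrite [expR B * _]mulrCA E.
rewrite -[X in expR C * (X + _)]mulr1 -mulrDr [expR C * _]mulrCA ler_wpM2l//.
apply: (@le_trans _ _ (expR C * expR (x * (h * s)))).
  by rewrite -expRD ler_expR; lra.
rewrite ler_pM2l ?expR_gt0//.
have [xs|/ltW xs] := leP 0 (x * s).
  by rewrite (@le_trans _ _ (expR (x * s)))// ?ler_expR ?lerDr//; nra.
rewrite (@le_trans _ _ 1)//; last by rewrite lerDl expR_ge0.
by rewrite -expR0 ler_expR; nra.
Qed.

(** * Means, tilts and divergences of the members of the family *)

Section exponential_family.
Context {R : realType}.
Variables (m : {measure set (measurableTypeR R) -> \bar R}) (Theta : set R).
Local Notation law := (probability (measurableTypeR R) R).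
Local Notation b := (log_partition m).

Definition has_param (theta : R) (rho : law) := forall A, measurable A ->
  rho A = (\int[m]_(x in A) (expR (x * theta - b theta))%:E)%E.

(** Integrating against [m] makes the mean a function of the parameter, without choosing a law;
    [mean_param] identifies it with the mean of any law of that parameter. *)
Definition param_mean (theta : R) : R :=
  fine (\int[m]_x (x * expR (x * theta - b theta))%:E)%E.

Local Notation M := param_mean.

Hypothesis hTheta : is_interval Theta.
Hypothesis hfin : forall theta, Theta theta -> (0 < laplace m theta < +oo)%E.

Lemma measurable_tilt (s c : R) :
  measurable_fun setT (fun x : measurableTypeR R => expR (x * s - c)).
Proof.
apply: measurableT_comp => //; apply: measurable_funB => //.
exact: measurable_funM.
Qed.
Hint Resolve measurable_tilt : core.

Lemma laplaceE theta : Theta theta -> laplace m theta = (expR (b theta))%:E.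
Proof.
move=> /hfin /andP[l0 ly]; rewrite /log_partition lnK ?fineK//.
  by rewrite ge0_fin_numE// ltW.
by rewrite posrE fine_gt0// l0.
Qed.

Lemma total_mass theta : Theta theta ->
  (\int[m]_x (expR (x * theta - b theta))%:E = 1)%E.
Proof.
move=> th; under eq_integral do rewrite expRD mulrC EFinM.
rewrite ge0_integralZl ?lee_fin ?expR_ge0//; last first.
- by apply/measurable_EFinP; apply: measurableT_comp => //; exact: measurable_funM.
rewrite -[X in (_ * X)%E]/(laplace m theta) laplaceE// -EFinM -expRD addNr.
by rewrite expR0.
Qed.

Lemma has_param_exists theta : Theta theta -> exists rho, has_param theta rho.
Proof.
move=> th; by apply: density_probability => //; exact: total_mass.
Qed.

Lemma has_param_expfam theta rho : Theta theta -> has_param theta rho ->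
  expfam m Theta rho.
Proof. by move=> th hr; exists theta. Qed.

Lemma change_of_param theta theta' rho (A : set (measurableTypeR R)) (f : measurableTypeR R ->
  \bar R) : has_param theta rho ->
  measurable A -> measurable_fun A f -> (forall x, A x -> 0 <= f x)%E ->
  (\int[m]_(x in A) (f x * (expR (x * theta' - b theta'))%:E) =
   \int[rho]_(x in A) (f x * (expR (x * (theta' - theta) - (b theta' - b theta)))%:E))%E.
Proof.
move=> hr mA mf f0.
have h0 x : 0 <= expR (x * theta - b theta) by exact: expR_ge0.
pose g x := (f x * (expR (x * (theta' - theta) - (b theta' - b theta)))%:E)%E.
have E := @ge0_integral_density _ _ _ m rho _ (measurable_tilt theta (b theta)) h0 hr g A mA.
transitivity (\int[m]_(x in A) (g x * (expR (x * theta - b theta))%:E))%E.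
  apply: eq_integral => x _; rewrite /g -muleA -EFinM -expRD.
  by congr (_ * (expR _)%:E)%E; move: (b _) (b _) => c c'; ring.
symmetry; apply: E.
- apply: emeasurable_funM => //; apply/measurable_EFinP.
  by apply: measurable_funTS; exact: measurable_tilt.
- by move=> x Ax; rewrite mule_ge0 ?f0// lee_fin expR_ge0.
Qed.

Lemma has_param_density theta theta' rho rho' (A : set (measurableTypeR R)) :
  has_param theta rho -> has_param theta' rho' -> measurable A ->
  rho' A = (\int[rho]_(x in A)
    (expR (x * (theta' - theta) - (b theta' - b theta)))%:E)%E.
Proof.
move=> hr hr' mA; rewrite hr'//.
have := @change_of_param theta theta' rho A (cst 1%E) hr mA.
under eq_integral do rewrite mul1e.
under [RHS]eq_integral do rewrite mul1e.
exact.
Qed.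

(** The total mass of the member [theta'], seen from the member [theta]: this is the exponential
    moment used in Chernoff's bound. *)
Lemma mgf_param theta theta' rho : Theta theta' -> has_param theta rho ->
  (\int[rho]_x (expR (x * (theta' - theta) - (b theta' - b theta)))%:E = 1)%E.
Proof.
move=> th' hr; have [rho' hr'] := has_param_exists th'.
by rewrite -(has_param_density hr hr')// probability_setT.
Qed.

Lemma param_integral theta rho (f : R -> R) : has_param theta rho ->
  measurable_fun setT f ->
  (\int[rho]_x (f x)%:E = \int[m]_x (f x * expR (x * theta - b theta))%:E)%E.
Proof.
move=> hr mf; have h0 x : 0 <= expR (x * theta - b theta) by exact: expR_ge0.
exact: (@integral_density _ _ _ m rho _ (measurable_tilt theta (b theta)) h0 hr).
Qed.

Lemma integrable_change theta theta' rho rho' (f : R -> R) :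
  has_param theta rho -> has_param theta' rho' -> measurable_fun setT f ->
  rho'.-integrable setT (EFin \o f) ->
  rho.-integrable setT
    (fun x => (f x * expR (x * (theta' - theta) - (b theta' - b theta)))%:E).
Proof.
move=> hr hr' mf fi.
have h0 x : 0 <= expR (x * (theta' - theta) - (b theta' - b theta)).
  exact: expR_ge0.
apply: (@integrable_densityr _ _ _ rho rho' _ _ h0) => //.
by move=> A mA; rewrite -(has_param_density hr hr').
Qed.

Lemma integral_change theta theta' rho rho' (f : R -> R) :
  has_param theta rho -> has_param theta' rho' -> measurable_fun setT f ->
  (\int[rho']_x (f x)%:E = \int[rho]_x
    (f x * expR (x * (theta' - theta) - (b theta' - b theta)))%:E)%E.
Proof.
move=> hr hr' mf.
have h0 x : 0 <= expR (x * (theta' - theta) - (b theta' - b theta)).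
  exact: expR_ge0.
apply: (@integral_density _ _ _ rho rho' _ _ h0) => //.
by move=> A mA; rewrite -(has_param_density hr hr').
Qed.

Variable V : R.
Hypothesis hV : forall rho, expfam m Theta rho -> ('V_rho[idfun] <= V%:E)%E.

Lemma integrable_id theta rho : Theta theta -> has_param theta rho ->
  rho.-integrable setT (EFin \o idfun).
Proof.
move=> th hr; have /hV := has_param_expfam th hr.
rewrite /variance covariance.unlock expectation.unlock /=.
(* [c] is a real number whether or not the expectation is already known to be finite, so the
   variance bound gives a finite second moment about [c], and [|x| <= 1 + (x - c) ^ 2 + |c|]. *)
set c := fine _ => hvar.
pose g (x : measurableTypeR R) := ((x - c) * (x - c)).
have gi : rho.-integrable setT (EFin \o g).
  apply/integrableP; split.
    by apply/measurable_EFinP; apply: measurable_funM; apply: measurable_funB.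
  under eq_integral do rewrite gee0_abs ?lee_fin -?expr2 ?sqr_ge0//.
  exact: (le_lt_trans hvar (ltry _)).
have gi2 : rho.-integrable setT (EFin \o (g \+ cst (1 + `|c|))).
  apply: (eq_integrable _ (fun x => (EFin \o g) x + cst (1 + `|c|)%:E x)%E) => //.
  by apply: integrableD => //; exact: finite_measure_integrable_cst.
apply: le_integrable gi2 => //=.
  by apply/measurable_EFinP; exact: measurable_id.
move=> x _; rewrite lee_fin.
have h1 : `|x - c| <= 1 + g x.
  have : 0 <= (`|x - c| - 1) ^+ 2 by exact: sqr_ge0.
  have : g x = `|x - c| ^+ 2 by rewrite /g -expr2 real_normK ?num_real.
  by move=> ->; nra.
apply: (@le_trans _ _ (g x + (1 + `|c|))); last exact: ler_norm.
have := ler_normD (x - c) c; rewrite subrK; lra.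
Qed.

Lemma mean_param theta rho : Theta theta -> has_param theta rho ->
  mean rho = (M theta)%:E.
Proof.
move=> th hr; have hi := integrable_id th hr.
rewrite /mean expectation.unlock /=.
have mid : measurable_fun setT (@idfun R) by exact: measurable_id.
have E := param_integral hr mid.
rewrite /param_mean /= in E *; rewrite -E fineK//.
by have := integrable_fin_num _ hi; apply.
Qed.

(** Jensen's inequality for the exponential: under [theta], the likelihood ratio [exp (x * s - B)]
    has integral 1 and its exponent has mean [c], whence [exp c <= 1]. *)
Lemma log_partition_tangent theta theta' : Theta theta -> Theta theta' ->
  b theta + M theta * (theta' - theta) <= b theta'.
Proof.
move=> th th'; have [rho hr] := has_param_exists th.
have hi := integrable_id th hr.
pose s := theta' - theta; pose B := b theta' - b theta; pose c := M theta * s - B.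
suff : expR c <= expR 0.
  by rewrite ler_expR /c /s /B; move: (b _) (b _) (M _) => *; lra.
have mg : (\int[rho]_x (expR (x * s - B))%:E = 1)%E by exact: mgf_param.
rewrite expR0 -lee_fin -mg.
have hM : (\int[rho]_x x%:E = (M theta)%:E)%E.
  by have := mean_param th hr; rewrite /mean expectation.unlock.
move: (M theta) B hM mg @c => mu B hM mg c.
(* The tangent line of the exponential at [c], composed with the exponent; its integral is
   [exp c]. *)
pose g x := expR c * (1 + (x * s - B) - c).
have gE : g = (fun x => expR c * s * x + expR c * (1 - mu * s)).
  by apply/funext => x; rewrite /g /c; ring.
have gi1 : rho.-integrable setT (fun x => (expR c * s)%:E * (EFin \o idfun) x)%E.
  exact: integrableZl.
have gi2 : rho.-integrable setT (fun x => cst (expR c * (1 - mu * s))%:E x).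
  exact: finite_measure_integrable_cst.
have Ig : (\int[rho]_x (g x)%:E = (expR c)%:E)%E.
  rewrite gE; under eq_integral do rewrite EFinD EFinM.
  rewrite integralD// integralZl// integral_cst//= hM.
  rewrite probability_setT mule1 -EFinM -EFinD; congr (_%:E); ring.
rewrite -Ig; apply: le_integral => //.
- have := integrableD measurableT gi1 gi2.
  by apply: eq_integrable => // x _; rewrite gE EFinD EFinM.
- apply/integrableP; split; first by apply/measurable_EFinP; exact: measurable_tilt.
  under eq_integral do rewrite gee0_abs ?lee_fin ?expR_ge0//.
  by rewrite mg ltry.
- move=> x _; rewrite lee_fin /g.
  set u := x * s - _; have -> : expR u = expR c * expR (u - c).
    by rewrite -expRD; congr expR; ring.
  rewrite ler_pM2l ?expR_gt0//.
  by apply: le_trans (expR_ge1Dx _); lra.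
Qed.

Lemma param_mean_change theta theta' rho : Theta theta' -> has_param theta rho ->
  ((M theta')%:E = \int[rho]_x
    (x * expR (x * (theta' - theta) - (b theta' - b theta)))%:E)%E.
Proof.
move=> th' hr; have [rho' hr'] := has_param_exists th'.
rewrite -(mean_param th' hr') /mean expectation.unlock.
have mid : measurable_fun setT (@idfun R) by exact: measurable_id.
exact: (integral_change hr hr' mid).
Qed.

(** Dominated convergence along the parameters [theta + s / n.+1], with all the means written as
    integrals under the law of parameter [theta]. The dominating function is integrable because the
    laws of both parameters have a mean. *)
Lemma param_mean_near theta theta' : Theta theta -> Theta theta' ->
  forall e : R, 0 < e ->
  exists k : R, 0 < k <= 1 /\ `|M (theta + k * (theta' - theta)) - M theta| < e.
Proof.
move=> th th' e e0; have [rho hr] := has_param_exists th.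
have [rho' hr'] := has_param_exists th'.
have hi := integrable_id th hr; have hi' := integrable_id th' hr'.
pose s := theta' - theta; pose h (n : nat) : R := n.+1%:R^-1.
have h0 n : 0 < h n by rewrite invr_gt0 ltr0n.
have h1 n : h n <= 1 by rewrite /h invf_le1 ?ltr0n// ler1n.
pose t n := theta + h n * s.
pose c n := b (t n) - b theta; pose C := (`|M theta| + `|M theta'|) * `|s|.
have C0 : 0 <= C by rewrite mulr_ge0// addr_ge0.
have tC n : Theta (t n) /\ `|c n| <= C * h n.
  by apply: (potential_segment hTheta log_partition_tangent th th'); rewrite h0 h1.
have hcvg : h n @[n --> \oo] --> 0 by exact: cvg_harmonic.
have c0 : c n @[n --> \oo] --> 0.
  apply: (@squeeze_cvgr _ _ _ _ (fun n => - (C * h n)) (fun n => C * h n)).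
  - by near=> n; rewrite -ler_norml; exact: (tC n).2.
  - by rewrite -oppr0 -[X in - X](mulr0 C); apply: cvgN; apply: cvgM => //; exact: cvg_cst.
  - by rewrite -[X in _ --> X](mulr0 C); apply: cvgM => //; exact: cvg_cst.
have Mcvg : (\int[rho]_x (x * expR (x * (h n * s) - c n))%:E)%E @[n --> \oo] -->
    (\int[rho]_x x%:E)%E.
  pose g (x : measurableTypeR R) := ((expR C)%:E * (`|x%:E| + (expR (b theta' - b theta))%:E *
    `|(x * expR (x * s - (b theta' - b theta)))%:E|))%E.
  apply: (@dominated_cvg _ _ _ _ _ _ _ _ g) => //.
  - move=> n; apply/measurable_EFinP; exact: measurable_funM.
  - move=> x _; apply: cvg_EFin; first exact: nearW.
    rewrite -[X in _ --> X]mulr1; apply: cvgM; first exact: cvg_cst.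
    have hz : x * (h n * s) - c n @[n --> \oo] --> (0 : R).
      rewrite -[X in _ --> X](subr0 0); apply: cvgB => //.
      rewrite -[X in _ --> X](mulr0 x); apply: cvgM; first exact: cvg_cst.
      by rewrite -[X in _ --> X](mul0r s); apply: cvgM => //; exact: cvg_cst.
    by rewrite -expR0; apply: (@cvg_comp _ _ _ (fun n => x * (h n * s) - c n) expR \oo (nbhs (0
      : R)) _ hz (@continuous_expR R 0)).
  - apply: integrableZl => //; apply: integrableD => //.
      exact: integrable_abse.
    apply: integrableZl => //; apply: integrable_abse.
    exact: (integrable_change hr hr').
  - move=> n x _; apply: tilt_bound; first by rewrite h0 h1.
    apply: (le_trans (tC n).2); rewrite -[leRHS]mulr1; exact: ler_wpM2l.
have {}Mcvg : M (t n) @[n --> \oo] --> M theta.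
  have -> : (fun n => M (t n)) = fine \o (fun n => (\int[rho]_x (x * expR (x * (h n * s) - c
    n))%:E)%E).
    apply/funext => n /=; have [Tt _] := tC n.
    have E : t n - theta = h n * s by rewrite /t addrC addKr.
    by rewrite -[LHS]/(fine (M (t n))%:E) (param_mean_change Tt hr) E.
  apply: fine_cvg; rewrite -(mean_param th hr).
  by rewrite /mean expectation.unlock; exact: Mcvg.
have [/= N _ hN] := (cvgrPdist_lt _ _).1 Mcvg e e0.
exists (h N); rewrite h0 h1 distrC; split=> //.
exact: (hN N (leqnn _)).
Unshelve. all: by end_near. Qed.

Lemma KLdiv_param theta theta' rho rho' : Theta theta -> Theta theta' ->
  has_param theta rho -> has_param theta' rho' ->
  KLdiv rho rho' = (bregman b M theta theta')%:E.
Proof.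
move=> th th' hr hr'.
pose q (x : measurableTypeR R) := expR (x * (theta - theta') - (b theta - b theta')).
have mq : measurable_fun setT q by exact: measurable_tilt.
have dom : rho `<< rho'.
  apply/null_content_dominatesP => A mA A0.
  rewrite (has_param_density hr' hr mA); apply: null_set_integral => //.
  by apply/measurable_EFinP/measurable_funTS.
have domc : charge_of_finite_measure rho `<< rho' by [].
(* [q] has the same integrals as the Radon-Nikodym derivative over all measurable sets. The equality
   almost everywhere for [rho'] is then transferred to [rho], under which the logarithm, an affine
   function of [x], is integrated. *)
have RNq : ae_eq rho' setT (Radon_Nikodym (charge_of_finite_measure rho) rho') (EFin \o q).
  apply: integral_ae_eq => //.
  - exact: Radon_Nikodym_integrable.
  - exact/measurable_EFinP.
  - move=> E _ mE; rewrite -Radon_Nikodym_integral//.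
    exact: has_param_density.
have {}RNq := null_dominates_ae_eq measurableT dom RNq.
rewrite /KLdiv asboolT//.
pose k := theta - theta'; pose k0 := b theta - b theta'.
have hi := integrable_id th hr.
transitivity (\int[rho]_x (k * x - k0)%:E)%E.
  apply: ae_eq_integral => //.
  - rewrite (_ : (fun x => lne _) = (fun x => lne (fine
        (Radon_Nikodym (charge_of_finite_measure rho) rho' x))%:E)).
      apply: measurable_lne_EFin; apply: measurableT_comp => //.
    by apply/funext => x; rewrite fineK// Radon_Nikodym_fin_num.
  - by apply/measurable_EFinP; apply: measurable_funB => //; exact: measurable_funM.
  - move: RNq; apply: filterS => x /= /(_ I) -> _.
    by rewrite /= /q lt_geF ?expR_gt0// expRK mulrC.
under eq_integral do rewrite EFinB EFinM.
rewrite integralB//; last 2 first.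
- exact: integrableZl.
- exact: finite_measure_integrable_cst.
rewrite integralZl// integral_cst//= probability_setT mule1.
have := mean_param th hr; rewrite /mean expectation.unlock /= => ->.
rewrite -EFinM -EFinB /bregman /k /k0; congr (_%:E).
move: (b _) (b _) (M _) => *; ring.
Qed.

(** [member_of_mean] chooses an arbitrary law of the given mean; injectivity of [M] forces the
    chosen law to have the expected parameter. *)
Lemma KL_param theta theta' :
  (forall u v, Theta u -> Theta v -> M u = M v -> u = v) ->
  Theta theta -> Theta theta' ->
  KL (expfam m Theta) (M theta) (M theta') = bregman b M theta theta'.
Proof.
move=> inj th th'.
have H u : Theta u -> has_param u (member_of_mean (expfam m Theta) (M u)).
  move=> Tu; have [rho hr] := has_param_exists Tu.
  have [] : [set nu | expfam m Theta nu /\ mean nu = (M u)%:E]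
      (member_of_mean (expfam m Theta) (M u)).
    by apply: getPex; exists rho; split; [exact: has_param_expfam Tu hr|exact: mean_param].
  move: (member_of_mean _ _) => nu [v Tv hv] e.
  have vu := EFin_inj (etrans (esym e) (@mean_param v nu Tv hv)).
  by rewrite (inj _ _ Tu Tv vu).
by rewrite /KL (@KLdiv_param theta theta')//; exact: H.
Qed.

End exponential_family.

(** * Events and rewards of a bandit *)

Section off_null.
Import HBNNSimple.

(* No measurability of [f] and [g] is assumed: the weights of the policy
   involve [KL] at points that need not be means of the family. *)
Lemma ge0_le_integral_off_null {d} {T : measurableType d} {R : realType}
    (mu : {measure set T -> \bar R}) (E N : set T) (f g : T -> R) (c : R) :
  measurable E -> measurable N -> mu N = 0%E -> 0 < c ->
  (forall x, 0 <= f x) -> (forall x, 0 <= g x) ->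
  (forall x, E x -> ~ N x -> f x <= c * g x) ->
  (\int[mu]_(x in E) (f x)%:E <= c%:E * \int[mu]_(x in E) (g x)%:E)%E.
Proof.
move=> mE mN N0 c0 f0 g0 fg.
rewrite [X in (X <= _)%E]ge0_integralE; last by move=> x _; rewrite lee_fin.
(* The integral of [f] is the supremum over simple functions [h] below it. Divided by [c] and set to
   zero on [N], such an [h] lies below [g], and its integral is only divided by [c]. *)
apply: ge_ereal_sup => _ [h /= hf <-].
have mEN : measurable (E `\` N) by exact: measurableD.
have ci : 0 <= c^-1 by rewrite invr_ge0 ltW.
pose k := mul_nnsfun (scale_nnsfun h ci) (indic_nnsfun R mEN).
have kE x : k x = c^-1 * h x * \1_(E `\` N) x by [].
have hE x : ~ E x -> h x = 0%R.
  move=> nE; have := hf x; rewrite /patch memNset// lee_fin => h0.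
  by apply/eqP; rewrite eq_le h0/= fun_ge0.
have kg x : ((k x)%:E <= ((fun x => (g x)%:E) \_ E) x)%E.
  rewrite /patch; case: ifPn => [/set_mem Ex|/negP nE]; rewrite lee_fin kE.
    have [Nx|Nx] := pselect (N x).
      by rewrite indicE memNset ?mulr0//= => -[].
    rewrite indicE mem_set//= mulr1 mulrC ler_pdivrMr// mulrC.
    have := hf x; rewrite /patch mem_set// lee_fin => /le_trans; apply.
    exact: fg.
  by rewrite hE ?mulr0 ?mul0r// => /mem_set.
have hk : sintegral mu h = (c%:E * sintegral mu k)%E.
  have I (s : {nnsfun T >-> R}) : sintegral mu s = (\int[mu]_x (s x)%:E)%E.
    by rewrite integral_nnsfun// patch_setT.
  rewrite !I.
  rewrite -ge0_integralZl ?lee_fin ?(ltW c0)//; last 2 first.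
  - exact/measurable_EFinP/measurable_funP.
  - by move=> x _; rewrite lee_fin.
  have ms (s : {nnsfun T >-> R}) : measurable_fun setT (fun x => (s x)%:E).
    exact/measurable_EFinP/measurable_funP.
  apply: ge0_ae_eq_integral; [by []|exact: ms| | | |].
  - by apply: emeasurable_funM => //; exact: ms.
  - by move=> x _; rewrite lee_fin.
  - by move=> x _; rewrite mule_ge0 ?lee_fin// ltW.
  exists N; split => // x /= H; apply: contrapT => nN; apply: H => _.
  have -> : c^-1 * h x * mindic R mEN x = c^-1 * h x * \1_(E `\` N) x by [].
  rewrite -EFinM mulrA mulrA divff ?gt_eqF// mul1r.
  have [Ex|nE] := pselect (E x).
    by rewrite indicE mem_set// mulr1.
  by rewrite hE// mul0r.
rewrite hk; apply: lee_wpmul2l; first by rewrite lee_fin ltW.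
rewrite ge0_integralE; last by move=> x _; rewrite lee_fin.
by apply: ereal_sup_ubound; exists k.
Qed.

End off_null.

Section real_probability.
Context {d} {T : measurableType d} {R : realType} (P : probability T R).
Implicit Types A B : set T.

Definition real_pr A : R := fine (P A).

Lemma prE A : measurable A -> P A = (real_pr A)%:E.
Proof. by move=> mA; rewrite fineK// fin_num_measure. Qed.

Lemma pr_ge0 A : 0 <= real_pr A.
Proof. exact: fine_ge0. Qed.

Lemma pr_le A B : measurable A -> measurable B -> A `<=` B -> real_pr A <= real_pr B.
Proof.
by move=> mA mB AB; rewrite -lee_fin -!prE// le_measure ?inE.
Qed.

Lemma pr_le1 A : measurable A -> real_pr A <= 1.
Proof. by move=> mA; rewrite -lee_fin -prE// probability_le1. Qed.

Lemma pr_setC A : measurable A -> real_pr (~` A) = 1 - real_pr A.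
Proof.
move=> mA; apply: EFin_inj; rewrite -prE; last exact: measurableC.
by rewrite EFinB -prE// probability_setC.
Qed.

Lemma pr_null A N : measurable A -> measurable N -> P N = 0%E -> A `<=` N ->
  real_pr A = 0.
Proof.
move=> mA mN N0 AN; apply/eqP; rewrite eq_le pr_ge0 andbT.
by apply: le_trans (pr_le mA mN AN) _; rewrite /real_pr N0.
Qed.

Lemma pr_leU A B C : measurable A -> measurable B -> measurable C ->
  A `<=` B `|` C -> real_pr A <= real_pr B + real_pr C.
Proof.
move=> mA mB mC ABC; rewrite -lee_fin EFinD -!prE//.
apply: le_trans (measureU2 _ mB mC); apply: le_measure; rewrite ?inE//.
exact: measurableU.
Qed.

Lemma pr_le_bigcup A n (F : nat -> set T) : measurable A ->
  (forall i, measurable (F i)) -> (forall x, A x -> exists2 i, (i < n)%N & F i x) ->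
  real_pr A <= \sum_(i < n) real_pr (F i).
Proof.
move=> mA mF AF; rewrite -lee_fin -sumEFin -prE//.
under eq_bigr do rewrite -prE//.
apply: le_trans (Boole_inequality _ _); last by move=> i _.
apply: le_measure; rewrite ?inE//; first exact: bigsetU_measurable.
by move=> x /AF[i ni Fx]; rewrite -bigcup_mkord; exists i.
Qed.

Lemma pr_le_bigcup_fin (J : finType) A (F : J -> set T) : measurable A ->
  (forall i, measurable (F i)) -> (forall x, A x -> exists i, F i x) ->
  real_pr A <= \sum_i real_pr (F i).
Proof.
move=> mA mF AF; pose G n := if insub n is Some i then F (enum_val (i : 'I_#|J|)) else set0.
have mG n : measurable (G n) by rewrite /G; case: insubP.
apply: (@le_trans _ _ (\sum_(i < #|J|) real_pr (G i))).
  apply: pr_le_bigcup => // x /AF[i Fx]; exists (enum_rank i) => //.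
  by rewrite /G valK enum_rankK.
rewrite [leRHS](reindex_onto enum_val enum_rank) => [|i _]; last exact: enum_rankK.
rewrite [leRHS]big_mkcond/=; apply: ler_sum => i _.
by rewrite enum_valK eqxx /G valK.
Qed.

Lemma pr_sum_disjoint A n (F : nat -> set T) : measurable A ->
  (forall i, measurable (F i)) -> trivIset setT F -> (forall i, (i < n)%N -> F i `<=` A) ->
  \sum_(i < n) real_pr (F i) <= real_pr A.
Proof.
move=> mA mF tF FA; rewrite -lee_fin -sumEFin -prE//.
under eq_bigr do rewrite -prE//.
rewrite -(measure_bigsetU _ mF tF).
apply: le_measure; rewrite ?inE//; first exact: bigsetU_measurable.
by move=> x; rewrite -bigcup_mkord => -[i /= ni Fx]; exact: FA Fx.
Qed.

End real_probability.

Lemma integral_mrestr {d} {T : measurableType d} {R : realType}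
    (mu : {measure set T -> \bar R}) (A : set T) (mA : measurable A) (f : T -> \bar R) :
  measurable_fun setT f -> (forall x, 0 <= f x)%E ->
  (\int[mrestr mu mA]_x f x = \int[mu]_x (f x * (\1_A x)%:E))%E.
Proof.
move=> mf f0; apply: (@ge0_integral_density _ _ _ mu (mrestr mu mA) (\1_A)) => //.
  by move=> B mB; rewrite integral_indic// setIC.
Qed.

(** * The past of a round as a measurable space *)

Section bandit.
Context {R : realType} {d : measure_display} {Omega : measurableType d}.
Variables (P : probability Omega R) (K : nat).
Variables (I : nat -> Omega -> 'I_K) (r : nat -> {RV P >-> R}).
Local Notation law := (probability (measurableTypeR R) R).
Hypothesis hI : forall t a, measurable (I t @^-1` [set a]).

Definition history_generators (t : nat) : set (set Omega) :=
  [set E | exists2 i, (1 <= i <= t)%N &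
         (exists a, E = I i @^-1` [set a]) \/
         (exists2 B : set (measurableTypeR R), measurable B & E = r i @^-1` B)].

(** [Omega] with the sigma-algebra of the first [t] rounds: being determined by the past becomes
    measurability on this space. *)
Definition past (t : nat) := g_sigma_algebraType (history_generators t).

Lemma history_measurable t E : history I r t E -> measurable E.
Proof.
apply: smallest_sub; first exact: sigma_algebra_measurable.
move=> _ [i _ [[a ->]|[B mB ->]]]; first exact: hI.
by rewrite -[X in measurable X]setTI; exact: (measurable_funP (r i)).
Qed.

Lemma measurable_past t : measurable_fun setT (fun w : Omega => (w : past t)).
Proof. by move=> _ E mE; rewrite setTI; exact: (@history_measurable t). Qed.

Lemma measurable_past_fun {d'} {U : measurableType d'} t (f : Omega -> U) :
  measurable_fun setT (f : past t -> U) -> measurable_fun setT f.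
Proof.
by move=> mf; exact: (measurableT_comp mf (@measurable_past t)).
Qed.

Lemma measurable_arm t i a : (1 <= i <= t)%N ->
  measurable_fun setT (fun w : past t => (I i w == a)%:R : R).
Proof.
move=> it.
rewrite (_ : (fun w => _) = \1_(I i @^-1` [set a] : set (past t))).
  apply: measurable_indic; apply: sub_sigma_algebra; exists i => //.
  by left; exists a.
by apply/funext => w; rewrite indicE; case: eqP => h; [rewrite mem_set|rewrite memNset].
Qed.

Lemma measurable_reward t i : (1 <= i <= t)%N ->
  measurable_fun setT (fun w : past t => r i w : measurableTypeR R).
Proof.
move=> it _ B mB; rewrite setTI; apply: sub_sigma_algebra; exists i => //.
by right; exists B.
Qed.

Lemma measurable_pulls t s a : (s <= t)%N ->
  measurable_fun setT (fun w : past t => (pulls I s a w)%:R : R).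
Proof.
move=> st; rewrite (_ : (fun w => _) = (fun w : past t => \sum_(1 <= i < s.+1) (I i w == a)%:R)).
  (* Measurability of the sum is derived from that of every indexed term, so the terms at rounds
     outside [1..t], absent from the sum, are replaced by 0. *)
  rewrite (_ : (fun w => _) = (fun w : past t => \sum_(i <- index_iota 1 s.+1) if (i <= t)%N &&
    (1 <= i)%N then (I i w == a)%:R else 0)).
    apply: measurable_sum => i; case: (boolP ((i <= t)%N && (0 < i)%N)) => [/andP[it i1]|_];
      last exact: measurable_cst.
    by apply: measurable_arm; rewrite i1.
  apply/funext => w; apply: eq_big_nat => i /andP[i1 si].
  by rewrite i1 (leq_trans _ st).
by apply/funext => w; rewrite /pulls natr_sum.
Qed.

Definition reward_sum t a w := \sum_(1 <= i < t.+1 | I i w == a) r i w.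

Lemma measurable_reward_sum t s a : (s <= t)%N ->
  measurable_fun setT (fun w : past t => reward_sum s a w).
Proof.
move=> st; rewrite (_ : (fun w => _) = (fun w : past t => \sum_(i <- index_iota 1 s.+1) if (i <=
  t)%N && (1 <= i)%N then (I i w == a)%:R * r i w else 0)).
  apply: measurable_sum => i; case: (boolP ((i <= t)%N && (0 < i)%N)) => [/andP[it i1]|_]; last
    exact: measurable_cst.
  apply: measurable_funM; first by apply: measurable_arm; rewrite i1.
  by apply: measurable_reward; rewrite i1.
apply/funext => w; rewrite /reward_sum big_mkcond/=; apply: eq_big_nat => i /andP[i1 si].
by rewrite i1 (leq_trans _ st)//; case: ifP; rewrite ?mul1r ?mul0r.
Qed.

Lemma pullsS t a w : pulls I t.+1 a w = (pulls I t a w + (I t.+1 w == a))%N.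
Proof. by rewrite /pulls big_nat_recr. Qed.

Lemma pulls_le s t a w : (s <= t)%N -> (pulls I s a w <= pulls I t a w)%N.
Proof.
move=> /subnK <-; elim: (t - s)%N => [//|n IH].
by rewrite addSn pullsS (leq_trans IH)// leq_addr.
Qed.

Lemma reward_sumS t a w :
  reward_sum t.+1 a w = reward_sum t a w + (if I t.+1 w == a then r t.+1 w else 0).
Proof.
by rewrite /reward_sum big_mkcond [in RHS]big_mkcond/= big_nat_recr.
Qed.

Lemma hist_pulls t s a k : (s <= t)%N ->
  history I r t [set w | pulls I s a w = k].
Proof.
move=> st; have := measurable_pulls a st; move=> /(_ measurableT [set k%:R]).
rewrite setTI => /(_ (measurable_set1 _)); congr (history _ _ _ _).
apply/seteqP; split => w /=; last by move=> ->.
by move=> /eqP; rewrite eqr_nat => /eqP.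
Qed.

Lemma histI t A B : history I r t A -> history I r t B -> history I r t (A `&` B).
Proof. by move=> hA hB; exact: (@measurableI _ (past t)). Qed.

Lemma histC t A : history I r t A -> history I r t (~` A).
Proof. by move=> hA; exact: (@measurableC _ (past t)). Qed.

Lemma histT t : history I r t setT.
Proof. exact: (@measurableT _ (past t)). Qed.

Lemma hist_forall (J : finType) t (A : J -> set Omega) :
  (forall j, history I r t (A j)) -> history I r t [set w | forall j, A j w].
Proof.
move=> hA; rewrite (_ : [set w | _] = \bigcap_(j in [set: J]) A j).
  apply: (@fin_bigcap_measurable _ (past t)); first exact: finite_finset.
  by move=> j _; exact: hA.
apply/seteqP; split => w /= H j; [by move=> _; exact: H|exact: H].
Qed.

Lemma hist_exists (J : finType) t (A : J -> set Omega) :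
  (forall j, history I r t (A j)) -> history I r t [set w | exists j, A j w].
Proof.
move=> hA; rewrite (_ : [set w | _] = \bigcup_(j in [set: J]) A j).
  apply: (@fin_bigcup_measurable _ (past t)); first exact: finite_finset.
  by move=> j _; exact: hA.
by apply/seteqP; split => w /= [j]; exists j.
Qed.

Lemma pulls_max t a w : (pulls I t a w <= t)%N.
Proof.
elim: t => [|t IH]; first by rewrite /pulls big_geq.
by rewrite pullsS -addn1 leq_add// leq_b1.
Qed.

(** Splitting according to the number of pulls makes the random denominator constant; the value 0,
    with its default quotient, is one of the cases. *)
Lemma hist_emp_mean t s a (A : set (measurableTypeR R)) : (s <= t)%N -> measurable A ->
  history I r t [set w | A (emp_mean I r s a w)].
Proof.
move=> st mA; rewrite (_ : [set w | _] = [set w | exists k : 'I_s.+1,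
    ([set w | pulls I s a w = k] `&` [set w | A (reward_sum s a w / (k : nat)%:R)]) w]).
  apply: hist_exists => k; apply: histI; first exact: hist_pulls.
  have mf : measurable_fun setT (fun w : past t => reward_sum s a w / (k : nat)%:R :
    measurableTypeR R).
    by apply: measurable_funM => //; exact: measurable_reward_sum.
  by have := mf measurableT A mA; rewrite setTI.
apply/seteqP; split => w /=; last by move=> [k [e]]; rewrite /emp_mean e.
move=> Aw; have h : (pulls I s a w < s.+1)%N by rewrite ltnS pulls_max.
by exists (Ordinal h).
Qed.

Lemma hist_arm t i a : (1 <= i <= t)%N -> history I r t (I i @^-1` [set a]).
Proof.
by move=> it; apply: sub_sigma_algebra; exists i => //; left; exists a.
Qed.

Variable nu : 'I_K -> law.
Hypothesis hrewards : bandit_rewards I r nu.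

Lemma measurable_pre_reward t (h : R -> R) : measurable_fun setT h ->
  measurable_fun setT (fun w => h (r t w)).
Proof. by move=> mh; apply: measurableT_comp => //; exact: measurable_funP. Qed.

(** On the event that arm [a] is pulled after [E], the reward has as image measure the law [nu a]
    scaled by the probability of that event. *)
Lemma integral_reward t a E (h : R -> R) : history I r t E ->
  measurable_fun setT h -> (forall x, 0 <= h x) ->
  (\int[nu a]_x (h x)%:E = 1)%E ->
  (\int[P]_(w in E `&` I t.+1 @^-1` [set a]) (h (r t.+1 w))%:E =
   P (E `&` I t.+1 @^-1` [set a]))%E.
Proof.
move=> hE mh h0 h1; set A := _ `&` _.
have mA : measurable A.
  by apply: measurableI; [exact: history_measurable hE|exact: hI].
have mr : measurable_fun setT (r t.+1 : Omega -> measurableTypeR R).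
  exact: (measurable_funP (r t.+1)).
have mhE : measurable_fun setT (fun x : measurableTypeR R => (h x)%:E).
  exact/measurable_EFinP.
have E1 := @ge0_integral_pushforward _ _ Omega (measurableTypeR R) R (r t.+1)
  mr (mrestr P mA) setT (fun x => (h x)%:E) measurableT mhE (fun x _ => h0 x).
rewrite preimage_setT in E1.
have E2 : (\int[mrestr P mA]_w (h (r t.+1 w))%:E =
    \int[P]_(w in A) (h (r t.+1 w))%:E)%E.
  rewrite integral_mrestr//; last 2 first.
  - by apply/measurable_EFinP; exact: measurable_pre_reward.
  - by move=> w; rewrite lee_fin.
  rewrite [RHS]integral_mkcond; apply: eq_integral => w _.
  by rewrite epatch_indic.
rewrite -E2; apply: (etrans (esym E1)).
have pA0 : 0 <= fine (P A) by exact: fine_ge0.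
rewrite (eq_measure_integral (mscale (NngNum pA0) (nu a))); last first.
  move=> B mB _.
  change (P (r t.+1 @^-1` B `&` A) = (fine (P A))%:E * nu a B)%E.
  by rewrite fineK ?fin_num_measure// setIC /A hrewards.
rewrite ge0_integral_mscale//; last by move=> x _; rewrite lee_fin.
by rewrite h1 mule1 /= fineK// fin_num_measure.
Qed.

(** Given the past and the pulled arm, [h] of the reward has conditional mean 1. The measures with
    densities [h (r t.+1)] and 1 on the event that [a] is pulled agree on the past by
    [integral_reward], hence integrate [f] alike. *)
Lemma integral_past_reward t a (f : Omega -> R) (h : R -> R) :
  measurable_fun setT (f : past t -> R) -> (forall w, 0 <= f w) ->
  measurable_fun setT h -> (forall x, 0 <= h x) ->
  (\int[nu a]_x (h x)%:E = 1)%E ->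
  (\int[P]_(w in I t.+1 @^-1` [set a]) (f w * h (r t.+1 w))%:E =
   \int[P]_(w in I t.+1 @^-1` [set a]) (f w)%:E)%E.
Proof.
move=> mf f0 mh h0 h1; set A := I _ @^-1` _.
have mA : measurable A by exact: hI.
have mf' : measurable_fun setT f by exact: measurable_past_fun mf.
have mhr : measurable_fun setT (fun w => h (r t.+1 w)) by exact: measurable_pre_reward.
pose g w := h (r t.+1 w) * \1_A w.
have g0 w : 0 <= g w by rewrite mulr_ge0.
have mg : measurable_fun setT g by apply: measurable_funM.
have [rho rhoE] := density_measure P mg g0.
have mfE : measurable_fun setT (fun w : past t => (f w)%:E) by exact/measurable_EFinP.
have mid := @measurable_past t.
have f0E : {in [set: past t], forall w, (0 <= (f w)%:E)%E} by move=> w _; rewrite lee_fin.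
have E1 := @ge0_integral_pushforward _ _ Omega (past t) R _ mid rho setT _ measurableT mfE f0E.
have E2 := @ge0_integral_pushforward _ _ Omega (past t) R _ mid (mrestr P mA) setT _ measurableT
  mfE f0E.
rewrite !preimage_setT in E1 E2.
have E3 : (\int[rho]_w (f w)%:E = \int[P]_(w in A) (f w * h (r t.+1 w))%:E)%E.
  rewrite (@ge0_integral_density _ _ _ P rho g)//; last 2 first.
  - exact/measurable_EFinP.
  - by move=> w _; rewrite lee_fin.
  rewrite [RHS]integral_mkcond; apply: eq_integral => w _.
  by rewrite epatch_indic -!EFinM /g mulrA.
have E4 : (\int[mrestr P mA]_w (f w)%:E = \int[P]_(w in A) (f w)%:E)%E.
  rewrite integral_mrestr//; last exact/measurable_EFinP.
  rewrite [RHS]integral_mkcond; apply: eq_integral => w _.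
  by rewrite epatch_indic.
rewrite -E3 -E4.
transitivity (\int[pushforward rho (fun w : Omega => (w : past t))]_w (f w)%:E)%E.
  by rewrite E1.
transitivity (\int[pushforward (mrestr P mA) (fun w : Omega => (w : past t))]_w (f w)%:E)%E.
  apply: eq_measure_integral => E mE _.
  transitivity (P (E `&` A)); last by [].
  rewrite /pushforward /= rhoE; last exact: (@history_measurable t).
  rewrite -(integral_reward mE mh h0 h1) [RHS]integral_mkcondr.
  by apply: eq_integral => w _; rewrite epatch_indic -EFinM.
by rewrite E2.
Qed.

End bandit.

(** * A Chernoff bound for empirical means *)

Section chernoff.
Context {R : realType} {d : measure_display} {Omega : measurableType d}.
Variables (P : probability Omega R) (K : nat).
Variables (I : nat -> Omega -> 'I_K) (r : nat -> {RV P >-> R}).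
Local Notation law := (probability (measurableTypeR R) R).
Hypothesis hI : forall t a, measurable (I t @^-1` [set a]).
Variable nu : 'I_K -> law.
Hypothesis hrewards : bandit_rewards I r nu.
Local Notation pulls := (pulls I).
Local Notation emp_mean := (emp_mean I r).
Local Notation reward_sum := (reward_sum I r).
Local Notation hist := (history I r).
Local Notation past := (past I r).
Local Notation pr := (real_pr P).
Let hm t E : hist t E -> measurable E := @history_measurable _ _ _ P K I r hI t E.

Lemma hist_pulls_pred t s a (Q : nat -> Prop) : (s <= t)%N ->
  hist t [set w | Q (pulls s a w)].
Proof.
move=> st; rewrite (_ : [set w | _] = [set w | exists k : 'I_s.+1,
    (if `[< Q k >] then [set w | pulls s a w = k] else set0) w]).
  apply: hist_exists => k; case: ifPn => _; first exact: hist_pulls.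
  by rewrite -[set0]setCK setC0; apply: histC; exact: histT.
apply/seteqP; split => w /=.
  move=> Qw; have h : (pulls s a w < s.+1)%N by rewrite ltnS pulls_max.
  by exists (Ordinal h); rewrite /= asboolT.
by move=> [k]; case: ifPn => // /asboolP Qk /= ->.
Qed.

(** The empirical mean of [a] changes only when [a] is pulled, so this event concerns the mean of
    its first [k] rewards, whenever they are collected by round [T]. *)
Definition hit (T : nat) (a : 'I_K) (k : nat) (A : set R) : set Omega :=
  [set w | exists s : 'I_T.+1, ([set w | pulls s a w = k] `&` [set w | A (emp_mean s a w)]) w].

Definition pulled_at (t : nat) (a : 'I_K) (k : nat) (A : set R) : set Omega :=
  [set w | pulls t a w = k] `&` [set w | A (emp_mean t a w)].

Lemma hist_pulled_at t a k (A : set (measurableTypeR R)) : measurable A ->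
  hist t (pulled_at t a k A).
Proof. by move=> mA; apply: histI; [exact: hist_pulls|exact: hist_emp_mean]. Qed.

Lemma hist_hit T a k (A : set (measurableTypeR R)) : measurable A -> hist T (hit T a k A).
Proof.
move=> mA; apply: hist_exists => s; have sT : (s <= T)%N by rewrite -ltnS.
by apply: histI; [exact: hist_pulls|exact: hist_emp_mean].
Qed.

Lemma pulled_at_hit t T a k A : (t <= T)%N -> pulled_at t a k A `<=` hit T a k A.
Proof. by rewrite -ltnS => tT w H; exists (Ordinal tT). Qed.

(* At most one round is the [k+1]-st pull of [a], whence a single probability
   bounds the sum over all rounds. *)
Lemma sum_pr_pull_le T a k (A : set (measurableTypeR R)) : measurable A ->
  \sum_(t < T) pr (pulled_at t a k A `&` I t.+1 @^-1` [set a]) <= pr (hit T a k A).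
Proof.
move=> mA.
apply: (@pr_sum_disjoint _ _ _ P _ T (fun t => pulled_at t a k A `&` I t.+1 @^-1` [set a])).
- exact: hm (@hist_hit _ _ _ _ mA).
- move=> t; apply: measurableI; last exact: hI.
  exact: hm (@hist_pulled_at _ _ _ _ mA).
- have key s t w : (s < t)%N -> pulls s a w = k -> I s.+1 w = a -> pulls t a w = k -> False.
    move=> st es Is et; have := pulls_le I a w st.
    by rewrite pullsS Is eqxx es et addn1 ltnn.
  move=> s t _ _ [w [[[/= es _] Is] [[et _] It]]].
  by case: (ltngtP s t) => // st; exfalso; [exact: (key s t w)|exact: (key t s w)].
- by move=> t tT w [H _]; exact: (pulled_at_hit (ltnW tT) H).
Qed.

Section supermartingale.
Variables (a : 'I_K) (k : nat) (l psi : R).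
Hypothesis mgf1 : (\int[nu a]_x (expR (l * x - psi))%:E = 1)%E.

(** The exponential martingale of the rewards of [a], stopped after the [k]-th pull. *)
Let Y t w := \prod_(1 <= i < t.+1)
  (if (I i w == a) && (pulls i.-1 a w < k)%N then expR (l * r i w - psi) else 1).

Let Y0 w : Y 0 w = 1.
Proof. by rewrite /Y big_geq. Qed.

Let YS t w : Y t.+1 w = Y t w *
  (if (I t.+1 w == a) && (pulls t a w < k)%N then expR (l * r t.+1 w - psi) else 1).
Proof. by rewrite /Y big_nat_recr. Qed.

Let Y_ge0 t w : 0 <= Y t w.
Proof. by apply: prodr_ge0 => i _; case: ifP => _ //; exact: expR_ge0. Qed.

Let mh : measurable_fun setT (fun x : R => expR (l * x - psi)).
Proof.
by apply: measurableT_comp => //; apply: measurable_funB => //; exact: measurable_funM.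
Qed.

Let measurable_hist_indic t E : hist t E -> measurable_fun setT (\1_E : past t -> R).
Proof. by move=> hE; exact: (@measurable_indic _ (past t)). Qed.

Let measurable_Y t s : (s <= t)%N -> measurable_fun setT (Y s : past t -> R).
Proof.
elim: s => [_|s IH st].
  by rewrite (_ : Y 0 = cst 1) //; apply/funext => w; exact: Y0.
pose E := I s.+1 @^-1` [set a] `&` [set w | (pulls s a w < k)%N].
have hE : hist t E.
  apply: histI; first by apply: hist_arm; rewrite st.
  exact: (@hist_pulls_pred t s a (fun n => (n < k)%N) (ltnW st)).
rewrite (_ : Y s.+1 = (fun w => Y s w * (\1_E w * expR (l * r s.+1 w - psi) + \1_(~` E) w))).
  apply: measurable_funM; first exact: IH (ltnW st).
  apply: measurable_funD; last by apply: measurable_hist_indic; exact: histC.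
  apply: measurable_funM; first exact: measurable_hist_indic.
  by apply: (measurableT_comp mh); apply: measurable_reward; rewrite st.
apply/funext => w; rewrite YS; congr (_ * _).
rewrite !indicE in_setC; case: ifPn => [/andP[/eqP e lt]|H].
  by rewrite mem_set//= mul1r addr0.
rewrite memNset ?mul0r ?add0r// => -[/= e lt].
by move: H; rewrite e eqxx lt.
Qed.

Let integral_Y t : (\int[P]_w (Y t w)%:E = 1)%E.
Proof.
elim: t => [|t IH].
  rewrite (_ : (fun w => _) = cst 1%E); last by apply/funext => w; rewrite Y0.
  by rewrite (integral_cst P measurableT 1) mul1e; exact: probability_setT.
pose A := I t.+1 @^-1` [set a]; pose B := [set w | (pulls t a w < k)%N].
have hB : hist t B by exact: (@hist_pulls_pred t t a (fun n => (n < k)%N) (leqnn _)).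
have mA : measurable A by exact: hI.
have mB : measurable B by exact: hm hB.
have mY : measurable_fun setT (Y t) := measurable_past_fun hI (measurable_Y (leqnn t)).
have mhr : measurable_fun setT (fun w => expR (l * r t.+1 w - psi)).
  exact: (measurable_pre_reward r t.+1 mh).
have h0 x : 0 <= expR (l * x - psi) by exact: expR_ge0.
pose f w := Y t w * \1_B w.
have mf : measurable_fun setT (f : past t -> R).
  by apply: measurable_funM; [exact: measurable_Y|exact: measurable_hist_indic].
have f0 w : 0 <= f w by rewrite mulr_ge0.
have E1 := @integral_past_reward _ _ _ P K I r hI nu hrewards t a f _ mf f0 mh h0 mgf1.
rewrite -/A integral_mkcond [in RHS]integral_mkcond in E1.
have mf' : measurable_fun setT f by exact: measurable_past_fun mf.
(* The product gains a factor only if [a] is pulled and has fewer than [k] pulls. On that event the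
   factor has conditional mean 1, with [f] as a weight known from the past. *)
transitivity (\int[P]_w ((Y t w * \1_(~` (A `&` B)) w)%:E + (f w * expR (l * r t.+1 w - psi) *
  \1_A w)%:E))%E.
  apply: eq_integral => w _; rewrite YS -EFinD; congr (_%:E).
  rewrite /f -!mulrA -mulrDr !indicE in_setC in_setI; congr (_ * _).
  have [Aw|Aw] := pselect (A w); have [Bw|Bw] := pselect (B w).
  - rewrite (mem_set Aw) (mem_set Bw) /= add0r mul1r mulr1.
    by move: Aw Bw => /= -> ->; rewrite eqxx.
  - rewrite (mem_set Aw) (memNset Bw) /= mul0r addr0.
    by move: Bw => /= /negP/negbTE ->; rewrite andbF.
  - rewrite (memNset Aw) (mem_set Bw) /= mulr0 mul1r addr0.
    by case: eqP => // e; case: Aw.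
  - rewrite (memNset Aw) (memNset Bw) /= mul0r addr0.
    by case: eqP => // e; case: Aw.
rewrite ge0_integralD//; first last.
- by apply/measurable_EFinP; apply: measurable_funM => //; exact: measurable_funM.
- by move=> w _; rewrite lee_fin !mulr_ge0 ?expR_ge0.
- apply/measurable_EFinP; apply: measurable_funM => //; apply: measurable_indic.
  by apply: measurableC; exact: measurableI.
- by move=> w _; rewrite lee_fin mulr_ge0.
rewrite (_ : (\int[P]_w (f w * _ * _)%:E = \int[P]_w (f w * \1_A w)%:E)%E); last first.
  move: E1; rewrite (_ : _ \_ A = fun w => (f w * expR (l * r t.+1 w - psi) * \1_A w)%:E); last
    first.
    by apply/funext => w; rewrite epatch_indic.
  by move=> ->; apply: eq_integral => w _; rewrite epatch_indic.
rewrite -ge0_integralD//; first last.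
- by apply/measurable_EFinP; apply: measurable_funM.
- by move=> w _; rewrite lee_fin !mulr_ge0.
- apply/measurable_EFinP; apply: measurable_funM => //; apply: measurable_indic.
  by apply: measurableC; exact: measurableI.
- by move=> w _; rewrite lee_fin mulr_ge0.
rewrite -[RHS]IH; apply: eq_integral => w _; rewrite -EFinD; congr (_%:E).
rewrite /f !indicE in_setC in_setI.
by case: (w \in A); case: (w \in B); rewrite /= ?(mulr0, mulr1, mul0r, addr0, add0r).
Qed.

Let Y_eq s w : (pulls s a w <= k)%N ->
  Y s w = expR (l * reward_sum s a w - psi * (pulls s a w)%:R).
Proof.
elim: s => [_|s IH].
  by rewrite Y0 /reward_sum /Defs.pulls !big_geq// !mulr0 subr0 expR0.
rewrite pullsS YS reward_sumS; case: eqP => e /=; last first.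
  by rewrite addn0 addr0 mulr1 => /IH.
rewrite addn1 => lt; rewrite lt IH ?(ltnW lt)// -expRD; congr expR.
rewrite -natr1; ring.
Qed.

Let Y_frozen s t w : (s <= t)%N -> (k <= pulls s a w)%N -> Y t w = Y s w.
Proof.
move=> /subnK <- ks; elim: (t - s)%N => [//|n IH].
rewrite addSn YS IH ltnNge (leq_trans ks) ?andbF ?mulr1//.
by apply: pulls_le; rewrite leq_addl.
Qed.

(** Markov's inequality for [Y T]. After the [k]-th pull the martingale is frozen, so its value at
    [T] is the one at the hitting round, at least [exp (k * dlt)]: one bound covers all the rounds,
    uniformly in [T]. *)
Lemma pr_hit_le_expR T (A : set (measurableTypeR R)) (dlt : R) : measurable A ->
  (0 < k)%N -> (forall x, A x -> dlt <= l * x - psi) ->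
  pr (hit T a k A) <= expR (- (k%:R * dlt)).
Proof.
move=> mA k0 HA; set C := hit _ _ _ _.
have mC : measurable C by exact: hm (@hist_hit _ _ _ _ mA).
have mY : measurable_fun setT (Y T) := measurable_past_fun hI (measurable_Y (leqnn T)).
have YC w : C w -> expR (k%:R * dlt) <= Y T w.
  move=> [s [/= es As]]; have sT : (s <= T)%N by rewrite -ltnS.
  rewrite (@Y_frozen s)//; last by rewrite es.
  rewrite Y_eq es// ler_expR.
  have -> : reward_sum s a w = emp_mean s a w * k%:R.
    by rewrite /emp_mean es divfK// pnatr_eq0 -lt0n.
  rewrite mulrA [psi * _]mulrC [leRHS](_ : _ = k%:R * (l * emp_mean s a w - psi)); last by ring.
  by rewrite ler_wpM2l// HA.
rewrite expRN -[leRHS]mul1r ler_pdivlMr ?expR_gt0//.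
rewrite -lee_fin -(integral_Y T) EFinM -prE// muleC -integral_cst//.
rewrite [leLHS]integral_mkcond; apply: ge0_le_integral => //.
- by move=> w _; rewrite patchE; case: ifP => // _; rewrite lee_fin expR_ge0.
- apply/(measurable_restrictT _ _).1 => //.
- exact/measurable_EFinP.
- by move=> w _; rewrite patchE; case: ifPn => [/set_mem/YC|_]; rewrite lee_fin.
Qed.

End supermartingale.
End chernoff.

(** * The expected number of pulls of a suboptimal arm *)

Lemma max_armE {R : realType} (K : nat) (f : 'I_K -> R) : (0 < K)%N ->
  exists2 c, max_arm f = f c & forall a, f a <= f c.
Proof.
move=> K0; pose a0 := Ordinal K0.
pose c := [arg max_(i > a0) f i]%O.
have fc a : f a <= f c by rewrite /c; case: arg_maxP => // i _; exact.
exists c => //; apply/eqP; rewrite eq_le; apply/andP; split.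
  by apply: ge_sup; [exists (f c), c|move=> _ [a _ <-]].
apply: ub_le_sup; last by exists c.
by exists (f c) => _ [a _ <-].
Qed.

Lemma sum_expRN_le {R : realType} (c : R) n : 0 < c ->
  \sum_(k < n) expR (- (k%:R * c)) <= (1 - expR (- c))^-1.
Proof.
move=> c0; have q1 : expR (- c) < 1 by rewrite -expR0 ltr_expR oppr_lt0.
have q0 : 0 < expR (- c) by exact: expR_gt0.
rewrite -[leRHS]mul1r ler_pdivlMr ?subr_gt0//.
under eq_bigr do rewrite -mulrN expRM_natl.
rewrite mulrC -opprB mulNr -subrX1 opprB lerBlDr lerDl exprn_ge0//.
Qed.

(** The pattern of the counting arguments below: a union bound over [k] at each round, then a bound
    for each [k] on the sum over the rounds. *)
Lemma sum_le_exchange {R : realType} n p (f : nat -> nat -> R) (B : nat -> R) (g : nat -> R) :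
  (forall t, (t < n)%N -> g t <= \sum_(k < p) f t k) ->
  (forall k, (k < p)%N -> \sum_(t < n) f t k <= B k) ->
  \sum_(t < n) g t <= \sum_(k < p) B k.
Proof.
move=> gf fB; apply: (@le_trans _ _ (\sum_(t < n) \sum_(k < p) f t k)).
  by apply: ler_sum => t _; exact: gf.
by rewrite exchange_big/=; apply: ler_sum => k _; exact: fB.
Qed.

Lemma exists_switch (Q : nat -> Prop) n : Q 0%N -> ~ Q n ->
  exists j, [/\ (j < n)%N, Q j & ~ Q j.+1].
Proof.
move=> Q0; elim: n => [//|n IH] nQ.
have [Qn|nQn] := pselect (Q n); first by exists n.
by have [j [jn Qj nQj]] := IH nQn; exists j; split => //; exact: ltnW.
Qed.

(** With [h = 1 / (k + 1)], from [exp (- h) <= 1 / (1 + h)], the left-hand side is at most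
    [(1 + h) / h = k + 2]. *)
Lemma geometric_expR_le {R : realType} k : (1 - expR (- (k.+1%:R^-1 : R)))^-1 <= k.+2%:R.
Proof.
have k0 : 0 < (k.+1%:R : R) by rewrite ltr0n.
pose h : R := k.+1%:R^-1; have h0 : 0 < h by rewrite invr_gt0.
have e0 : expR (- h) <= (1 + h)^-1.
  by rewrite expRN lef_pV2 ?posrE ?expR_gt0 ?addr_gt0// expR_ge1Dx.
have E : (1 + h)^-1 = 1 - k.+2%:R^-1.
  have -> : 1 + h = k.+2%:R / k.+1%:R by rewrite /h -(natr1 k.+1) mulrDl divff ?gt_eqF// mul1r.
  have k2 : (k.+2%:R : R) != 0 by rewrite pnatr_eq0.
  by rewrite invf_div -[X in X - _](divff k2) -(natr1 k.+1) -[X in _ - X]mul1r -mulrBl addrK.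
have k2 : 0 < (k.+2%:R^-1 : R) by rewrite invr_gt0.
rewrite -/h; move: e0; rewrite E => e0.
have ze : k.+2%:R^-1 <= 1 - expR (- h) by move: (k.+2%:R^-1) e0 => z; lra.
have : (1 - expR (- h))^-1 <= (k.+2%:R^-1)^-1.
  by rewrite lef_pV2 ?posrE// (lt_le_trans k2).
by rewrite invrK.
Qed.

(** Half of the exponent absorbs the linear factor, since [1 + y <= exp y]; the other half is kept
    for a geometric sum. *)
Lemma linear_expR_le {R : realType} (c : R) k : 0 < c ->
  k.+2%:R * expR (- (k.+1%:R * c)) <= (1 + 2 / c) * expR (- (k%:R * (c / 2))).
Proof.
move=> c0; set n : R := k.+1%:R.
have n0 : 0 <= n by rewrite ler0n.
have e1 : k.+2%:R <= (1 + 2 / c) * expR (n * (c / 2)).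
  apply: (@le_trans _ _ ((1 + 2 / c) * (1 + n * (c / 2)))); last first.
    by rewrite ler_wpM2l ?expR_ge1Dx// addr_ge0// divr_ge0// ltW.
  have h1 : 0 <= 2 / c by rewrite divr_ge0// ltW.
  have h2 : 0 <= n * (c / 2) by rewrite mulr_ge0// divr_ge0// ltW.
  have h3 : 2 / c * (n * (c / 2)) = n by field; rewrite gt_eqF.
  have -> : (1 + 2 / c) * (1 + n * (c / 2)) =
    1 + n * (c / 2) + 2 / c + 2 / c * (n * (c / 2)) by ring.
  by rewrite h3 -natr1 -/n; lra.
have -> : - (n * c) = - (n * (c / 2)) - n * (c / 2) by field.
rewrite expRD mulrA; apply: ler_pM.
- by rewrite mulr_ge0 ?expR_ge0.
- exact: expR_ge0.
- by rewrite expRN ler_pdivrMr ?expR_gt0.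
- rewrite ler_expR lerN2 ler_wpM2r//; first by rewrite divr_ge0// ltW.
  by rewrite ler_nat.
Qed.

(** [T ^ (1 - e) * ln T] is negligible before [T]: half of the decay [T ^ (- e)] absorbs the
    logarithm, and the other half is at most [1 / H]. *)
Lemma eventually_small {R : realType} (A B c e dlt : R) :
  0 <= B -> 0 < c -> 0 < e -> 0 < dlt ->
  exists T0 : nat, forall T, (T0 <= T)%N ->
    A + B * (T%:R * expR (- (e * ln T%:R)) * (ln T%:R / c + 1)) <= dlt * T%:R.
Proof.
move=> B0 c0 e0 d0.
(* [H] brings the product of the constants below [dlt / 2]; the summand 1 ensures [1 <= H]. Beyond
   [exp L0] one has [H <= T ^ (e / 2)]. *)
pose H := B * (2 / (e * c) + 1) * (2 / dlt) + 1.
have ec0 : 0 < e * c by rewrite mulr_gt0.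
have q0 : 0 < 2 / (e * c) + 1 by rewrite addr_gt0// divr_gt0.
have H1 : 1 <= H by rewrite /H lerDr; apply: mulr_ge0; [apply: mulr_ge0 => //; exact:
  ltW|rewrite divr_ge0// ltW].
have H0 : 0 < H by exact: lt_le_trans H1.
pose L0 := ln H * (2 / e).
exists (Num.truncn (Num.max (expR L0) (2 * A / dlt))).+1 => T TT0.
have TM : Num.max (expR L0) (2 * A / dlt) < T%:R.
  by apply: lt_le_trans (truncnS_gt _) _; rewrite ler_nat.
move: TM; rewrite gt_max => /andP[TL TA].
have T0 : 0 < (T%:R : R) by apply: lt_trans (expR_gt0 _) TL.
have hA : A <= dlt / 2 * T%:R.
  by move: TA; rewrite ltr_pdivrMr// => /ltW; lra.
set L := ln T%:R.
have LL0 : L0 <= L by rewrite -[L0]expRK /L ler_ln ?posrE ?expR_gt0// ltW.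
have hH : H <= expR (e / 2 * L).
  rewrite -[leLHS](lnK (_ : H \is Num.pos)) ?posrE// ler_expR.
  have -> : ln H = e / 2 * L0 by rewrite /L0; field; rewrite gt_eqF.
  by rewrite ler_wpM2l// divr_ge0// ltW.
have L1 : L / c + 1 <= (2 / (e * c) + 1) * expR (e / 2 * L).
  have h1 : e / 2 * L <= expR (e / 2 * L) by apply: le_trans (expR_ge1Dx _); rewrite lerDr.
  have -> : L / c = 2 / (e * c) * (e / 2 * L) by field; rewrite !gt_eqF.
  rewrite [leRHS](mulrDl (2 / (e * c)) 1) mul1r lerD//; last exact: le_trans hH.
  by rewrite ler_wpM2l// divr_ge0// ltW.
have h2 : expR (- (e * L)) * (L / c + 1) <= (2 / (e * c) + 1) / H.
  apply: (@le_trans _ _ (expR (- (e * L)) * ((2 / (e * c) + 1) * expR (e / 2 * L)))).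
    by rewrite ler_wpM2l ?expR_ge0.
  rewrite mulrCA -expRD ler_wpM2l ?(ltW q0)//.
  have -> : - (e * L) + e / 2 * L = - (e / 2 * L) by field.
  by rewrite expRN lef_pV2 ?posrE ?expR_gt0.
have h3 : B * ((2 / (e * c) + 1) / H) <= dlt / 2.
  rewrite mulrA ler_pdivrMr//.
  have -> : dlt / 2 * H = B * (2 / (e * c) + 1) + dlt / 2.
    by rewrite /H; field; rewrite !gt_eqF.
  by rewrite lerDl divr_ge0// ltW.
have h4 : B * (T%:R * expR (- (e * L)) * (L / c + 1)) <= dlt / 2 * T%:R.
  apply: (@le_trans _ _ (T%:R * (B * ((2 / (e * c) + 1) / H)))); last by rewrite mulrC
    ler_wpM2r// ltW.
  by rewrite -mulrA mulrCA ler_wpM2l ?(ltW T0)// ler_wpM2l.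
lra.
Qed.

Lemma cvg_div_ln {R : realType} (f : nat -> R) (l : R) :
  (forall c, l < c -> exists C : R, forall T, (0 < T)%N -> f T <= c * ln T%:R + C) ->
  (forall c, c < l -> exists T0, forall T, (T0 <= T)%N -> c * ln T%:R <= f T) ->
  f T / ln T%:R @[T --> \oo] --> l.
Proof.
move=> up lo; apply/cvgrPdist_le => e e0.
have [|C HC] := up (l + e / 2); first by rewrite ltrDl divr_gt0.
have [|T0 HT0] := lo (l - e); first by rewrite gtrBl.
pose L0 := `|C| * (2 / e) + 1.
exists (maxn T0 (Num.truncn (expR L0)).+1) => // T /=; rewrite geq_max => /andP[TT0 TL].
have TE : expR L0 < T%:R.
  by apply: lt_le_trans (truncnS_gt _) _; rewrite ler_nat.
have Tpos : 0 < (T%:R : R) by apply: lt_trans TE; exact: expR_gt0.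
have LT : L0 < ln T%:R by rewrite -[L0]expRK ltr_ln ?posrE ?expR_gt0.
have L1 : 0 < ln (T%:R : R).
  by apply: le_lt_trans LT; rewrite /L0 addr_ge0// mulr_ge0// divr_ge0// ltW.
have CL : C <= e / 2 * ln T%:R.
  have : `|C| * (2 / e) <= ln T%:R by apply: le_trans (ltW LT); rewrite lerDl.
  rewrite -ler_pdivlMr ?divr_gt0// invf_div mulrC; exact/le_trans/ler_norm.
have T1 : (0 < T)%N by rewrite -(ltr0n R).
have h1 := HC T T1; have h2 := HT0 T TT0.
rewrite distrC ler_distl; apply/andP; split.
  by rewrite ler_pdivlMr.
rewrite ler_pdivrMr//; apply: (le_trans h1); lra.
Qed.

Lemma sum_ltn_le T K : (\sum_(t < T) (t < K)%N <= K)%N.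
Proof.
suff -> : (\sum_(t < T) (t < K)%N = minn T K)%N by rewrite geq_minr.
elim: T => [|T IH]; first by rewrite big_ord0 min0n.
by rewrite big_ord_recr /= IH; case: (ltnP T K) => h /=; lia.
Qed.

(** * Counting the pulls of an arm under the policy *)

Section bandit.
Context {R : realType} {d : measure_display} {Omega : measurableType d}.
Variables (P : probability Omega R) (K : nat).
Variables (I : nat -> Omega -> 'I_K) (r : nat -> {RV P >-> R}).
Local Notation law := (probability (measurableTypeR R) R).
Hypothesis hI : forall t a, measurable (I t @^-1` [set a]).
Variable nu : 'I_K -> law.
Hypothesis hrewards : bandit_rewards I r nu.
Variables (F : set law) (Theta : set R) (b M : R -> R).
Local Notation D := (bregman b M).
Hypothesis itv : is_interval Theta.
Hypothesis tangent : forall u v, Theta u -> Theta v -> b u + M u * (v - u) <= b v.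
Hypothesis strict : forall u v, Theta u -> Theta v -> u < v -> M u < M v.
Hypothesis near_mean : forall u v, Theta u -> Theta v -> forall e : R, 0 < e ->
  exists k : R, 0 < k <= 1 /\ `|M (u + k * (v - u)) - M u| < e.
Hypothesis hKL : forall u v, Theta u -> Theta v -> KL F (M u) (M v) = D u v.
Variable th : 'I_K -> R.
Hypothesis hth : forall a, Theta (th a).
Hypothesis hmgf : forall a v, Theta v ->
  (\int[nu a]_x (expR ((v - th a) * x - (b v - b (th a))))%:E = 1)%E.
Hypothesis K0 : (0 < K)%N.
Hypothesis hpolicy : follows_policy I r (expklms I r F).
(** All the almost sure facts are gathered in one null event, off which the policy has an explicit
    form. *)
Variable N : set Omega.
Hypothesis mN : measurable N.
Hypothesis PN : P N = 0%E.
Hypothesis Nmean : forall w, ~ N w -> forall t a, (0 < pulls I t a w)%N ->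
  exists2 u, Theta u & emp_mean I r t a w = M u.
Hypothesis Npulls : forall w, ~ N w -> forall t a, (K <= t)%N -> (0 < pulls I t a w)%N.

Local Notation pulls := (pulls I).
Local Notation emp_mean := (emp_mean I r).
Local Notation hist := (history I r).
Local Notation pr := (real_pr P).
Local Notation hit := (hit I r).
Local Notation pulled_at := (pulled_at I r).
Let hm t E : hist t E -> measurable E := @history_measurable _ _ _ P K I r hI t E.
Local Notation arm t a := (I t.+1 @^-1` [set a]).

(** Chernoff's bound with tilt [v - th a], the one that moves the mean to [M v]: its exponent at
    [M v] is exactly [D v (th a)]. *)
Lemma pr_hit_upper T a k v : (0 < k)%N -> Theta v -> th a <= v ->
  pr (hit T a k `[M v, +oo[) <= expR (- (k%:R * D v (th a))).
Proof.
move=> k0 Tv av; apply: (pr_hit_le_expR hI hrewards (hmgf a Tv)) => // x /=.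
rewrite in_itv/= andbT => Mx; rewrite /bregman.
have : (v - th a) * M v <= (v - th a) * x by rewrite ler_wpM2l// subr_ge0.
lra.
Qed.

Lemma pr_hit_lower T a k v : (0 < k)%N -> Theta v -> v <= th a ->
  pr (hit T a k `]-oo, M v]) <= expR (- (k%:R * D v (th a))).
Proof.
move=> k0 Tv av; apply: (pr_hit_le_expR hI hrewards (hmgf a Tv)) => // x /=.
rewrite in_itv/= => Mx; rewrite /bregman.
have : (th a - v) * x <= (th a - v) * M v by rewrite ler_wpM2l// subr_ge0.
lra.
Qed.

(** [q] gives the parameters of the empirical means and [c] an arm of largest one. The normalization
    [W] is at least 1, the weight of [c], and at most [K], as no weight exceeds 1. *)
Lemma policyE t w : (K <= t)%N -> ~ N w -> exists (q : 'I_K -> R) (c : 'I_K) (W : R),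
  [/\ forall a, Theta (q a) /\ emp_mean t a w = M (q a),
      forall a, q a <= q c, 1 <= W <= K%:R &
      forall a, expklms I r F t.+1 a w =
        expR (- (((pulls t a w)%:R - 1) * D (q a) (q c))) / W].
Proof.
move=> Kt nN.
have /choice[q qP] : forall a, exists u, Theta u /\ emp_mean t a w = M u.
  by move=> a; have [u Tu e] := Nmean nN (Npulls nN a Kt); exists u.
have [c ec cmax] := max_armE (fun a => emp_mean t a w) K0.
pose W := \sum_(a < K) expklms_weight I r F t.+1 a w.
have wE a : expklms_weight I r F t.+1 a w =
    expR (- (((pulls t a w)%:R - 1) * D (q a) (q c))).
  have [Ta ea] := qP a; have [Tc e] := qP c.
  by rewrite /expklms_weight /emp_max ec /= ea e hKL.
exists q, c, W; split => //.
- move=> a; have := cmax a; have [Ta ->] := qP a; have [Tc ->] := qP c.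
  by rewrite (mean_leE tangent strict).
- apply/andP; split.
    rewrite /W (bigD1 c)//= wE bregmanxx mulr0 oppr0 expR0 lerDl.
    by apply: sumr_ge0 => i _; exact: expR_ge0.
  rewrite -[K in leRHS]card_ord -sumr_const; apply: ler_sum => a _.
  rewrite wE -[leRHS]expR0 ler_expR oppr_le0 mulr_ge0//.
    by rewrite subr_ge0 ler1n Npulls.
  by have [Ta _] := qP a; have [Tc _] := qP c; exact: (bregman_ge0 tangent).
- by move=> a; rewrite /expklms ltnNge Kt /= wE.
Qed.

Lemma expklms_ge0 t a w : 0 <= expklms I r F t a w.
Proof.
rewrite /expklms; case: ifP => _ //; apply: divr_ge0; first exact: expR_ge0.
by apply: sumr_ge0 => i _; exact: expR_ge0.
Qed.

Let integral_const (E : set Omega) : measurable E ->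
  (\int[P]_(w in E) (1 : R)%:E = P E)%E.
Proof. by move=> mE; rewrite (integral_cst P mE 1) mul1e. Qed.

(** This and the next two lemmas turn pointwise comparisons of the policy, valid off [N], into
    comparisons of probabilities of pulls on an event of the past. *)
Lemma pull_le t E a c : hist t E -> 0 < c ->
  (forall w, E w -> ~ N w -> expklms I r F t.+1 a w <= c) ->
  pr (E `&` arm t a) <= c * pr E.
Proof.
move=> hE c0 H; have mE := hm hE.
rewrite -lee_fin EFinM -!prE//; last exact: measurableI.
rewrite hpolicy// -integral_const//.
apply: (ge0_le_integral_off_null mE mN PN c0 (expklms_ge0 _ _) (fun=> ler01)).
by move=> w Ew Nw; rewrite mulr1; exact: H.
Qed.

Lemma pull_ge t E a c : hist t E -> 0 < c ->
  (forall w, E w -> ~ N w -> 1 <= c * expklms I r F t.+1 a w) ->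
  pr E <= c * pr (E `&` arm t a).
Proof.
move=> hE c0 H; have mE := hm hE.
rewrite -lee_fin EFinM -!prE//; last exact: measurableI.
rewrite hpolicy// -integral_const//.
exact: (ge0_le_integral_off_null mE mN PN c0 (fun=> ler01) (expklms_ge0 _ _)).
Qed.

Lemma pull_ratio t E a a' c : hist t E -> 0 < c ->
  (forall w, E w -> ~ N w -> expklms I r F t.+1 a w <= c * expklms I r F t.+1 a' w) ->
  pr (E `&` arm t a) <= c * pr (E `&` arm t a').
Proof.
move=> hE c0 H; have mE := hm hE.
rewrite -lee_fin EFinM -!prE//; try exact: measurableI.
rewrite !hpolicy//.
exact: (ge0_le_integral_off_null mE mN PN c0 (expklms_ge0 _ _) (expklms_ge0 _ _)).
Qed.

Lemma pr_off_null A B : measurable A -> measurable B -> A `\` N `<=` B -> pr A <= pr B.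
Proof.
move=> mA mB AB; have pN : pr N = 0 by rewrite /real_pr PN.
rewrite -[leRHS]addr0 -pN; apply: pr_leU => // w Aw; have [Nw|nNw] := pselect (N w); first by
  right.
by left; apply: AB.
Qed.

(** The index [t] stands for round [t.+1], so the sum covers rounds [1] to [T]. *)
Definition exp_pulls a T : R := \sum_(t < T) pr (arm t a).

Let hpa t a k (A : set (measurableTypeR R)) : measurable A -> hist t (pulled_at t a k A).
Proof. by move=> mA; exact: hist_pulled_at. Qed.

Let hc t (Q : Prop) : hist t [set w : Omega | Q].
Proof.
have [q|q] := pselect Q.
  by rewrite (_ : [set w | _] = setT); [exact: histT|apply/seteqP; split].
rewrite (_ : [set w | _] = ~` setT); first by apply: histC; exact: histT.
by rewrite setCT; apply/seteqP; split.
Qed.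

Let he t a (A : set (measurableTypeR R)) : measurable A -> hist t [set w | A (emp_mean t a w)].
Proof. by move=> mA; exact: hist_emp_mean. Qed.

Let hp t s a (Q : nat -> Prop) : (s <= t)%N -> hist t [set w | Q (pulls s a w)].
Proof. exact: hist_pulls_pred. Qed.

Let hh T a k (A : set (measurableTypeR R)) : measurable A -> hist T (hit T a k A).
Proof. by move=> mA; exact: hist_hit. Qed.

Lemma sum_pr_emp_pull_le T a (A : set (measurableTypeR R)) (B : nat -> R) :
  measurable A -> (forall k, (k < T)%N -> pr (hit T a k.+1 A) <= B k) ->
  \sum_(t < T) pr ([set w | (0 < pulls t a w)%N] `&` [set w | A (emp_mean t a w)] `&` arm t a)
  <= \sum_(k < T) B k.
Proof.
move=> mA HB.
apply: (@sum_le_exchange _ T T (fun t k => pr (pulled_at t a k.+1 A `&` arm t a)) B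
  (fun t => pr ([set w | (0 < pulls t a w)%N] `&` [set w | A (emp_mean t a w)] `&` arm t a))).
  move=> t tT; apply: (@pr_le_bigcup _ _ _ P _ T (fun k => pulled_at t a k.+1 A `&` arm t a)).
  - apply: measurableI => //; refine (hm (t:=t) _); apply: histI; last exact: he.
    exact: (@hp t t a (fun n => (0 < n)%N) (leqnn t)).
  - by move=> k; apply: measurableI => //; exact: hm (@hpa _ _ _ _ mA).
  - move=> w [[/= p0 Aw] Iw]; exists (pulls t a w).-1.
      by rewrite prednK//; exact: leq_trans (pulls_max I t a w) (ltnW tT).
    by split => //; split => //=; rewrite prednK.
move=> k kT; apply: le_trans (HB k kT).
exact: (sum_pr_pull_le r hI).
Qed.

(** The half-line of [bregman_level], whose end [u0] satisfies [D u0 (th a) >= D u0 y + D y (th a)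
    >= s + D y (th a)]; this is the exponent of Chernoff's bound. *)
Lemma level_set a y s : Theta y -> y <= th a -> exists U : set (measurableTypeR R),
  [/\ measurable U, forall u, Theta u -> U (M u) <-> u <= y /\ s <= D u y &
      forall T k, (0 < k)%N -> pr (hit T a k U) <= expR (- (k%:R * (s + D y (th a))))].
Proof.
move=> Ty ya.
have [H|[u0 [Tu0 u0y su0 umax]]] := bregman_level itv tangent near_mean s Ty.
  exists set0; split => //.
    move=> u Tu; split=> // -[uy su].
    by have := H u Tu uy; rewrite ltNge su.
  move=> T k k0; rewrite (_ : hit T a k set0 = set0).
    by rewrite /pr measure0 expR_ge0.
  by apply/seteqP; split => // w [s0 []].
exists `]-oo, M u0]%classic; split => //.
  move=> u Tu; rewrite /= in_itv/= (mean_leE tangent strict)//; split => [uu0|[uy su]].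
    split; first exact: le_trans uu0 u0y.
    by apply: (le_trans su0); apply: (bregman_monol tangent) => //; left; rewrite uu0.
  exact: umax.
move=> T k k0; apply: le_trans (pr_hit_lower T k0 Tu0 (le_trans u0y ya)) _.
rewrite ler_expR lerN2 ler_wpM2l//.
apply: le_trans (bregman_triangle tangent Tu0 Ty (hth a) (or_introl _)); last first.
  by rewrite u0y.
by rewrite lerD2r.
Qed.

(** Pulls of [a] are charged to pulls of [a1] made at the same count and level of underestimation of
    [a1]; each count of [a1] is left by at most one pull, which removes the sum over the rounds. *)
Lemma sum_pr_underestimate_le a a1 y : Theta y -> y < th a1 -> exists C : R, forall T,
  \sum_(t < T) pr ([set w | (K <= t)%N] `&` [set w | forall c, emp_mean t c w <= M y] `&` arm t a)
  <= C.
Proof.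
move=> Ty ya; set c0 := D y (th a1).
have c0_gt0 : 0 < c0 by apply: (bregman_gt0 itv tangent strict) => //; rewrite lt_eqF.
pose G (c : R) := (1 - expR (- c))^-1.
exists (expR 1 * (1 + 2 / c0) * G (c0 / 2) + G c0) => T.
(* Slicing [D q y] into levels of width [1 / k.+1] costs only a factor [expR 1]
   after multiplication by [k]. *)
pose s (k j : nat) : R := j%:R / k.+1%:R.
have /choice[U UP] : forall kj : nat * nat, exists U : set (measurableTypeR R),
  [/\ measurable U, forall u, Theta u -> U (M u) <-> u <= y /\ s kj.1 kj.2 <= D u y &
      forall T k, (0 < k)%N -> pr (hit T a1 k U) <= expR (- (k%:R * (s kj.1 kj.2 + c0)))].
  by move=> kj; exact: level_set (ltW ya).
pose E4 t := [set w | (K <= t)%N] `&` [set w | forall c, emp_mean t c w <= M y].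
pose g t k j := E4 t `&` pulled_at t a1 k.+1 (U (k, j) `&` ~` U (k, j.+1)).
pose tl t k := pulled_at t a1 k.+1 (U (k, T)).
have mU k j : measurable (U (k, j)) by have [] := UP (k, j).
have hE4 t : hist t (E4 t).
  apply: histI; first exact: hc.
  apply: (@hist_forall _ _ _ _ _ _ _ _ t (fun c => [set w | emp_mean t c w <= M y])) => c.
  rewrite (_ : [set w | _] = [set w | `]-oo, M y]%classic (emp_mean t c w)]); first exact: he.
  by apply/seteqP; split => w /=; rewrite in_itv.
have mUU k j : measurable (U (k, j) `&` ~` U (k, j.+1)).
  by apply: measurableI => //; exact: measurableC.
have hg t k j : hist t (g t k j) by apply: histI => //; exact: hpa.
have htl t k : hist t (tl t k) by exact: hpa.
(* The last index collects the levels beyond [T / k.+1]. There the pull of [a] is dropped, as the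
   factor [exp (- T)] compensates for the [T] rounds. *)
pose W t k j := if (j < T)%N then g t k j `&` arm t a else tl t k.
have mW t k j : measurable (W t k j).
  rewrite /W; case: ifP => _; last exact: (hm (htl t k)).
  by apply: measurableI => //; exact: (hm (hg t k j)).
pose f t k := \sum_(j < T.+1) pr (W t k j).
(* The exponent is [k * s k j.+1 - k.+1 * (s k j + c0)]: the ratio of the two pull probabilities
   against the Chernoff bound at level [j]. *)
pose B1 (k j : nat) := expR (1 - j.+1%:R / k.+1%:R - k.+1%:R * c0).
pose B k := \sum_(j < T) B1 k j + expR (- (k%:R * c0)).
have mE t : measurable (E4 t `&` arm t a).
  by apply: measurableI => //; exact: (hm (hE4 t)).
apply: (@le_trans _ _ (\sum_(k < T) B k)).
  apply: (@sum_le_exchange _ T T f B (fun t => pr (E4 t `&` arm t a))) => [t tT|k kT].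
    rewrite /f pair_big/=.
    apply: (@le_trans _ _ (pr ((E4 t `&` arm t a) `\` N))).
      by apply: pr_off_null => //; exact: measurableD.
    apply: (@pr_le_bigcup_fin _ _ _ P _ _ (fun kj : 'I_T * 'I_T.+1 => W t kj.1 kj.2)) => //.
      exact: measurableD.
    move=> w [[[/= Kt ey] Iw] nN].
    have p0 := Npulls nN a1 Kt.
    have [u Tu eu] := Nmean nN p0.
    have uy : u <= y by rewrite -(mean_leE tangent strict)// -eu; exact: ey.
    have kT : ((pulls t a1 w).-1 < T)%N by rewrite prednK// (leq_trans (pulls_max _ _ _ _)) //
      ltnW.
    pose k := Ordinal kT; pose Q j := U ((k : nat), j) (M u).
    have ek : k.+1 = pulls t a1 w by rewrite /= prednK.
    have [QT|nQT] := pselect (Q T).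
      exists (k, ord_max); rewrite /W /= ltnn; split; first by rewrite /= prednK.
      by rewrite /= eu.
    have Q0 : Q 0%N.
      rewrite /Q; have [_ -> // _] := UP ((k : nat), 0%N); split => //=.
      by rewrite /s mul0r; exact: (bregman_ge0 tangent).
    (* Level 0 always holds and level [T] fails, so some level holds while the next one fails. *)
    have [j [jT Qj nQj]] := exists_switch Q0 nQT.
    exists (k, widen_ord (leqnSn T) (Ordinal jT)); rewrite /W /= jT.
    split => //; split => //; split; first by rewrite /= prednK.
    by rewrite /= eu.
  rewrite /f; under eq_bigr do rewrite big_ord_recr/=.
  rewrite big_split/= lerD//.
    rewrite exchange_big/=; apply: ler_sum => j _.
    have jT := ltn_ord j; rewrite /W jT.
    pose sg := s k j.+1.
    apply: (@le_trans _ _ (expR (k%:R * sg) * \sum_(t < T) pr (g t k j `&` arm t a1))).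
      rewrite mulr_sumr; apply: ler_sum => t _.
      apply: pull_ratio => //; first exact: expR_gt0.
      move=> w [[/= Kt ey] [ek [Uj nUj]]] nN.
      (* With [k.+1] pulls of [a1], the factor in its weight is [k], and
         [D (q a1) (q c) <= D (q a1) y < sg]; the weight of [a] is at most 1. *)
      have [q [c [W0 [qP qc /andP[W1 _] pE]]]] := policyE Kt nN.
      rewrite !pE ek -natr1 addrK mulrA ler_pM2r ?invr_gt0 ?(lt_le_trans ltr01)//.
      have [Ta1 e1] := qP a1; have [Tc ec] := qP c; have [Ta _] := qP a.
      have qcy : q c <= y by rewrite -(mean_leE tangent strict)// -ec; exact: ey.
      have lt : D (q a1) y < sg.
        rewrite ltNge; apply/negP => le; apply: nUj; rewrite e1.
        by have [_ -> // _] := UP (k, j.+1); split => //; exact: le_trans (qc _) qcy.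
      have le : D (q a1) (q c) <= sg.
        by apply: (le_trans _ (ltW lt)); apply: (bregman_monor tangent) => //; left; rewrite qc
          qcy.
      apply: (@le_trans _ _ 1).
        rewrite -[leRHS]expR0 ler_expR oppr_le0 mulr_ge0 ?subr_ge0 ?ler1n ?Npulls//.
        exact: (bregman_ge0 tangent).
      by rewrite -expRD -[leLHS]expR0 ler_expR subr_ge0 ler_wpM2l.
    have [_ _ /(_ T k.+1 (ltn0Sn _)) hU] := UP (k, j : nat).
    apply: (@le_trans _ _ (expR (k%:R * sg) * pr (hit T a1 k.+1 (U (k, j : nat))))).
      apply: ler_wpM2l; first exact: expR_ge0.
      apply: (le_trans _ (sum_pr_pull_le r hI _ _ _ (mU k j))).
      apply: ler_sum => t _; apply: pr_le.
      - by apply: measurableI => //; exact: hm (hg t k j).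
      - by apply: measurableI => //; exact: hm (@hpa _ _ _ _ (mU k j)).
      - by move=> w [[_ [ek [Uj _]]] Iw].
    apply: (@le_trans _ _ (expR (k%:R * sg) * expR (- (k.+1%:R * (s k j + c0))))).
      by rewrite ler_wpM2l ?expR_ge0.
    rewrite -expRD ler_expR /sg /s /= le_eqVlt; apply/orP; left; apply/eqP.
    have k1 : (k.+1%:R : R) != 0 by rewrite pnatr_eq0.
    rewrite -(natr1 j); move: k1; rewrite -(natr1 k) => k1; field.
    exact: k1.
  have [_ _ /(_ T k.+1 (ltn0Sn _)) hU] := UP (k, T).
  apply: (@le_trans _ _ (\sum_(t < T) expR (- (T%:R + k.+1%:R * c0)))).
    apply: ler_sum => t _; rewrite /W ltnn.
    apply: (@le_trans _ _ (pr (hit T a1 k.+1 (U (k, T))))).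
      apply: pr_le; [exact: hm (htl t k)|exact: hm (@hh _ _ _ _ (mU k T))|].
      by apply: pulled_at_hit; exact: ltnW.
    apply: (le_trans hU); rewrite ler_expR lerN2 /s /= le_eqVlt; apply/orP; left; apply/eqP.
    have k1 : (k.+1%:R : R) != 0 by rewrite pnatr_eq0.
    by move: (k.+1%:R : R) k1 => x k1; field.
  rewrite sumr_const card_ord -[leLHS]mulr_natl opprD expRD mulrA.
  rewrite -[leRHS]mul1r; apply: ler_pM; rewrite ?mulr_ge0 ?expR_ge0//.
    rewrite expRN ler_pdivrMr ?expR_gt0// mul1r.
    by apply: le_trans (expR_ge1Dx _); rewrite lerDr.
  by rewrite ler_expR lerN2 ler_wpM2r ?(ltW c0_gt0)// ler_nat.
rewrite /B big_split/= lerD//; last exact: sum_expRN_le.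
apply: (@le_trans _ _ (\sum_(k < T) expR 1 * (1 + 2 / c0) * expR (- (k%:R * (c0 / 2))))).
  apply: ler_sum => k _; rewrite -mulrA.
  apply: (@le_trans _ _ (expR 1 * (k.+2%:R * expR (- (k.+1%:R * c0))))); last first.
    by rewrite ler_wpM2l ?expR_ge0// linear_expR_le.
  rewrite [k.+2%:R * _]mulrC mulrA -expRD.
  apply: (@le_trans _ _ (\sum_(j < T) expR (1 - k.+1%:R * c0) * expR (- (j%:R * k.+1%:R^-1)))).
    apply: ler_sum => j _; rewrite -expRD ler_expR.
    have : j%:R / k.+1%:R <= j.+1%:R / k.+1%:R :> R by rewrite ler_wpM2r ?invr_ge0// ler_nat.
    by move: (j%:R / k.+1%:R : R) (j.+1%:R / k.+1%:R : R) (k.+1%:R * c0) => p q u; lra.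
  rewrite -mulr_sumr ler_wpM2l ?expR_ge0//.
  apply: le_trans (geometric_expR_le k); apply: sum_expRN_le.
  by rewrite invr_gt0.
rewrite -mulr_sumr ler_wpM2l ?sum_expRN_le ?divr_gt0//.
by rewrite mulr_ge0 ?expR_ge0// addr_ge0// divr_ge0// ltW.
Qed.

Lemma hist_emp_le t a z : hist t [set w | emp_mean t a w <= z].
Proof.
rewrite (_ : [set w | _] = [set w | `]-oo, z]%classic (emp_mean t a w)]); first exact: he.
by apply/seteqP; split => w /=; rewrite in_itv.
Qed.

Lemma hist_emp_ge t a z : hist t [set w | z <= emp_mean t a w].
Proof.
rewrite (_ : [set w | _] = [set w | `[z, +oo[%classic (emp_mean t a w)]); first exact: he.
by apply/seteqP; split => w /=; rewrite in_itv /= andbT.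
Qed.

Lemma exp_pulls_upper a a1 x y : Theta x -> Theta y ->
  th a < x -> x < y -> y < th a1 ->
  exists C : R, forall T, (0 < T)%N -> exp_pulls a T <= ln T%:R / D x y + C.
Proof.
move=> Tx Ty ax xy ya.
have D0 : 0 < D x y by apply: (bregman_gt0 itv tangent strict) => //; rewrite lt_eqF.
have [C4 HC4] := sum_pr_underestimate_le a Ty ya.
pose c2 := D x (th a).
have c20 : 0 < c2 by apply: (bregman_gt0 itv tangent strict) => //; rewrite gt_eqF.
(* The constant parts of the five bounds below; the 2 comes from [n.+1 <= ln T / D x y + 2]. *)
exists (K%:R + 2 + (1 - expR (- c2))^-1 + 1 + C4) => T T0.
have lnT0 : 0 <= ln (T%:R : R) by rewrite ln_ge0// ler1n.
(* Rounding up gives [T * exp (- n * D x y) <= 1]. *)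
pose n := (Num.truncn (ln T%:R / D x y)).+1.
have n_gt : ln T%:R / D x y < n%:R by rewrite /n; exact: truncnS_gt.
have n_le : n%:R <= ln T%:R / D x y + 1.
  by rewrite /n -natr1 lerD2r truncn_le divr_ge0// ltW.
pose E3 t := [set w | (K <= t)%N] `&` ([set w | (n < pulls t a w)%N] `&`
  ([set w | emp_mean t a w <= M x] `&` [set w | exists c, M y <= emp_mean t c w])).
(* The initial rounds, then the four kinds of pulls. Kind 1 stops at [n] pulls included, so that in
   kind 3 the factor [pulls - 1] of the weight is at least [n]. *)
pose E (t i : nat) : set Omega := match i with
  | 0 => [set w | (t < K)%N]
  | 1 => [set w | (pulls t a w < n.+1)%N]
  | 2 => [set w | (0 < pulls t a w)%N] `&` [set w | `[M x, +oo[%classic (emp_mean t a w)]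
  | 3 => E3 t
  | _ => [set w | (K <= t)%N] `&` [set w | forall c, emp_mean t c w <= M y] end.
have hE3 t : hist t (E3 t).
  apply: histI; first exact: hc.
  apply: histI; first exact: (@hp t t a (fun k => (n < k)%N) (leqnn t)).
  apply: histI; first exact: hist_emp_le.
  by apply: (hist_exists (A := fun c => [set w | M y <= emp_mean t c w])) => c; exact:
    hist_emp_ge.
have hE t i : hist t (E t i).
  case: i => [|[|[|[|i]]]] /=.
  - exact: hc.
  - exact: (@hp t t a (fun k => (k < n.+1)%N) (leqnn t)).
  - apply: histI; first exact: (@hp t t a (fun k => (0 < k)%N) (leqnn t)).
    exact: (@he t a `[M x, +oo[%classic).
  - exact: hE3.
  - apply: histI; first exact: hc.
    by apply: (hist_forall (A := fun c => [set w | emp_mean t c w <= M y])) => c; exact: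
      hist_emp_le.
pose B i : R := match i with
  | 0 => K%:R | 1 => n.+1%:R | 2 => (1 - expR (- c2))^-1 | 3 => 1 | _ => C4 end.
have mE t i : measurable (E t i `&` arm t a).
  by apply: measurableI => //; exact: hm (hE t i).
apply: (@le_trans _ _ (\sum_(i < 5) B i)); last first.
  rewrite !big_ord_recr big_ord0 /= -(natr1 n); lra.
apply: (@sum_le_exchange _ T 5 (fun t i => pr (E t i `&` arm t a)) B (fun t => pr (arm t a))).
  move=> t tT; apply: (@pr_le_bigcup _ _ _ P _ 5 (fun i => E t i `&` arm t a)) => // w Iw.
  have [Kt|tK] := leqP K t; last by exists 0%N.
  have [nt|tn] := ltnP n (pulls t a w); last by exists 1%N.
  have [xe|ex] := leP (M x) (emp_mean t a w).
    exists 2%N => //; split => //; split => /=; first exact: leq_ltn_trans nt.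
    by rewrite in_itv/= xe.
  have [H|H] := pselect (exists c, M y <= emp_mean t c w).
    by exists 3%N => //; split => //; split => //; split => //; split => //=; exact: ltW.
  exists 4%N => //; split => //; split => //= c; rewrite leNgt; apply/negP => h.
  by apply: H; exists c; exact: ltW.
move=> i; case: i => [|[|[|[|[|//]]]]] _ /=.
- apply: (@le_trans _ _ (\sum_(t < T) (t < K)%N%:R)); last first.
    by rewrite -natr_sum ler_nat sum_ltn_le.
  apply: ler_sum => t _; change (pr (E t 0%N `&` arm t a) <= (t < K)%N%:R).
  case tK : (t < K)%N; first exact: pr_le1.
  rewrite (_ : _ `&` _ = set0); first by rewrite /real_pr measure0.
  by apply/seteqP; split => // w [/=]; rewrite tK.
- apply: (@le_trans _ _ (\sum_(k < n.+1) 1)); last first.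
    by rewrite sumr_const card_ord.
  apply: (@sum_le_exchange _ T n.+1 (fun t k => pr (pulled_at t a k setT `&` arm t a))
    (fun=> 1) (fun t => pr (E t 1%N `&` arm t a))) => [t tT|k kn].
    apply: (@pr_le_bigcup _ _ _ P _ n.+1 (fun k => pulled_at t a k setT `&` arm t a)) => //.
      by move=> k; apply: measurableI => //; exact: hm (@hpa t a k _ measurableT).
    by move=> w [/= lt Iw]; exists (pulls t a w).
  apply: (le_trans (sum_pr_pull_le r hI T a k measurableT)).
  by apply: pr_le1; exact: hm (@hh T a k _ measurableT).
- apply: le_trans (sum_expRN_le T c20).
  apply: (@sum_pr_emp_pull_le T a `[M x, +oo[%classic (fun k => expR (- (k%:R * c2)))) => // k kT.
  apply: le_trans (pr_hit_upper T (ltn0Sn k) Tx (ltW ax)) _.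
  by rewrite ler_expR lerN2 ler_wpM2r ?(ltW c20)// ler_nat.
- apply: (@le_trans _ _ (\sum_(t < T) expR (- (n%:R * D x y)))).
    apply: ler_sum => t _.
    apply: (@le_trans _ _ (expR (- (n%:R * D x y)) * pr (E3 t))); last first.
      by rewrite -[leRHS]mulr1 ler_wpM2l ?expR_ge0// pr_le1//; exact: hm (hE3 t).
    apply: pull_le => //; first exact: expR_gt0.
    move=> w [/= Kt [nt [ex [c1 yc]]]] nN.
    have [q [c [W0 [qP qc /andP[W1 _] pE]]]] := policyE Kt nN.
    have [Ta ea] := qP a; have [Tc ec] := qP c; have [Tc1 ec1] := qP c1.
    have qx : q a <= x by rewrite -(mean_leE tangent strict)// -ea.
    have qy : y <= q c.
      by apply: (le_trans _ (qc c1)); rewrite -(mean_leE tangent strict)// -ec1.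
    rewrite pE; apply: (@le_trans _ _ (expR (- (((pulls t a w)%:R - 1) * D (q a) (q c))))).
      rewrite ler_pdivrMr ?(lt_le_trans ltr01)// -[leLHS]mulr1 ler_wpM2l ?expR_ge0//.
    rewrite ler_expR lerN2; apply: ler_pM => //; first exact: ltW.
      by rewrite lerBrDr natr1 ler_nat.
    apply: (@le_trans _ _ (D x (q c))).
      by apply: (bregman_monor tangent) => //; left; rewrite (ltW xy).
    by apply: (bregman_monol tangent) => //; left; rewrite qx (le_trans (ltW xy)).
  rewrite sumr_const card_ord -[leLHS]mulr_natl expRN ler_pdivrMr ?expR_gt0// mul1r.
  rewrite -[leLHS](lnK (_ : _ \is Num.pos)) ?posrE ?ltr0n// ler_expR.
  by rewrite -ler_pdivrMr// ltW.
- exact: HC4.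
Qed.

(** * Lower bound on the expected number of pulls *)

Lemma sum_pr_few_pulls_le T a n :
  \sum_(t < T) pr ([set w | (pulls t a w < n)%N] `&` arm t a) <= n%:R.
Proof.
apply: (@le_trans _ _ (\sum_(k < n) 1)); last by rewrite sumr_const card_ord.
apply: (@sum_le_exchange _ T n (fun t k => pr (pulled_at t a k setT `&` arm t a))
  (fun=> 1) (fun t => pr ([set w | (pulls t a w < n)%N] `&` arm t a))) => [t tT|k kn].
  apply: (@pr_le_bigcup _ _ _ P _ n (fun k => pulled_at t a k setT `&` arm t a)) => //.
  - by apply: measurableI => //; exact: hm (@hp t t a (fun k => (k < n)%N) (leqnn t)).
  - by move=> k; apply: measurableI => //; exact: hm (@hpa t a k _ measurableT).
  - by move=> w [/= lt Iw]; exists (pulls t a w).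
apply: (le_trans (sum_pr_pull_le r hI T a k measurableT)).
by apply: pr_le1; exact: hm (@hh T a k _ measurableT).
Qed.

(** Markov's inequality for the number of pulls: reaching [n] pulls means leaving each count [k < n]
    at some round, and a round leaves only one count. *)
Lemma exp_pulls_ge a T n : n%:R * pr [set w | (n <= pulls T a w)%N] <= exp_pulls a T.
Proof.
have mn : measurable [set w | (n <= pulls T a w)%N].
  exact: hm (@hp T T a (fun k => (n <= k)%N) (leqnn T)).
have mpk t k : measurable (pulled_at t a k setT `&` arm t a).
  by apply: measurableI => //; exact: hm (@hpa t a k _ measurableT).
have -> : n%:R * pr [set w | (n <= pulls T a w)%N] =
    \sum_(k < n) pr [set w | (n <= pulls T a w)%N].
  by rewrite sumr_const card_ord mulr_natl.
apply: (@le_trans _ _ (\sum_(k < n) \sum_(t < T) pr (pulled_at t a k setT `&` arm t a))).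
  apply: ler_sum => k _.
  apply: (@pr_le_bigcup _ _ _ P _ T (fun t => pulled_at t a k setT `&` arm t a)) => // w /= nw.
  have [||t [tT /= le /negP]] := @exists_switch (fun t => (pulls t a w <= k)%N) T.
  - by rewrite /Defs.pulls big_geq.
  - by apply/negP; rewrite -ltnNge (leq_trans (ltn_ord k)).
  rewrite -ltnNge pullsS; case: eqP => [e|_]; last by rewrite addn0 ltnNge le.
  rewrite addn1 ltnS => ge; exists t => //; split => //; split => //=.
  by apply/eqP; rewrite eqn_leq le.
rewrite exchange_big/=; apply: ler_sum => t _.
apply: (@pr_sum_disjoint _ _ _ P _ n (fun k => pulled_at t a k setT `&` arm t a)) => //.
- by move=> i j _ _ [w [[[/= <- _] _] [[/= <- _] _]]].
Qed.

(** Either [z] is beyond [th a] and Chernoff's bounds sum to a geometric series, or [z] is the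
    largest parameter and no empirical mean exceeds [M z] off [N]. *)
Lemma sum_pr_overestimate_le a z : Theta z -> th a <= z ->
  (th a < z \/ forall w, Theta w -> w <= z) -> exists2 C : R, 0 <= C & forall T,
  \sum_(t < T) pr ([set w | (0 < pulls t a w)%N] `&`
    [set w | `]M z, +oo[%classic (emp_mean t a w)] `&` arm t a) <= C.
Proof.
move=> Tz _ [az|zmax].
  pose c := D z (th a).
  have c0 : 0 < c by apply: (bregman_gt0 itv tangent strict) => //; rewrite gt_eqF.
  have q1 : expR (- c) < 1 by rewrite -expR0 ltr_expR oppr_lt0.
  exists (1 - expR (- c))^-1 => [|T]; first by rewrite invr_ge0 subr_ge0 ltW.
  apply: le_trans (sum_expRN_le T c0).
  apply: (@sum_pr_emp_pull_le T a `]M z, +oo[%classic (fun k => expR (- (k%:R * c)))) => // k kT.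
  apply: (@le_trans _ _ (pr (hit T a k.+1 `[M z, +oo[))).
    apply: pr_le; [exact: hm (@hh _ _ _ _ (measurable_itv _))|exact: hm (@hh _ _ _ _
      (measurable_itv _))|].
    move=> w [s [/= es]]; rewrite in_itv/= andbT => h; exists s; split => //=.
    by rewrite in_itv/= andbT ltW.
  apply: le_trans (pr_hit_upper T (ltn0Sn k) Tz (ltW az)) _.
  by rewrite ler_expR lerN2 ler_wpM2r ?(ltW c0)// ler_nat.
exists 0 => // T; rewrite big1// => t _; apply: (pr_null _ mN PN).
  apply: measurableI => //; refine (hm (t:=t) _); apply: histI; last exact: he.
  exact: (@hp t t a (fun k => (0 < k)%N) (leqnn t)).
move=> w [[/= p0 ez] _]; apply: contrapT => nN.
have [u Tu eu] := Nmean nN p0; move: ez; rewrite in_itv/= andbT eu ltNge.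
by rewrite (mean_le tangent) ?zmax.
Qed.

Let hforall_le t z : hist t [set w | forall c, emp_mean t c w <= M z].
Proof.
by apply: (hist_forall (A := fun c => [set w | emp_mean t c w <= M z])) => c; exact: hist_emp_le.
Qed.

(** On each such round [a] is pulled with probability at least [exp (- n * D x z) / K], while at
    most [n.+1] pulls of [a] can occur at these counts. *)
Lemma sum_pr_low_count_le a x z n T : Theta x -> Theta z ->
  \sum_(t < T) pr ([set w | (K <= t)%N] `&` ([set w | forall c, emp_mean t c w <= M z] `&`
    ([set w | (pulls t a w < n.+1)%N] `&` [set w | M x <= emp_mean t a w])))
  <= K%:R * expR (n%:R * D x z) * n.+1%:R.
Proof.
move=> Tx Tz; pose E t := [set w | (K <= t)%N] `&` ([set w | forall c, emp_mean t c w <= M z] `&`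
    ([set w | (pulls t a w < n.+1)%N] `&` [set w | M x <= emp_mean t a w])).
have hE t : hist t (E t).
  apply: histI; first exact: hc.
  apply: histI; first exact: hforall_le.
  by apply: histI; [exact: (@hp t t a (fun k => (k < n.+1)%N) (leqnn t))|exact: hist_emp_ge].
have C0 : 0 < K%:R * expR (n%:R * D x z) by rewrite mulr_gt0 ?expR_gt0// ltr0n.
apply: (@le_trans _ _ (\sum_(t < T) K%:R * expR (n%:R * D x z) * pr (E t `&` arm t a))).
  apply: ler_sum => t _; apply: pull_ge => //.
  move=> w [/= Kt [ez [lt xe]]] nN.
  have [q [c [W0 [qP qc /andP[W1 WK] ->]]]] := policyE Kt nN.
  have [Ta ea] := qP a; have [Tc ec] := qP c.
  have qx : x <= q a by rewrite -(mean_leE tangent strict)// -ea.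
  have qz : q c <= z by rewrite -(mean_leE tangent strict)// -ec; exact: ez.
  have W00 : 0 < W0 by exact: lt_le_trans ltr01 W1.
  have le : D (q a) (q c) <= D x z.
    apply: (@le_trans _ _ (D x (q c))).
      by apply: (bregman_monol tangent) => //; left; rewrite qx qc.
    by apply: (bregman_monor tangent) => //; left; rewrite qz (le_trans qx).
  rewrite mulrA ler_pdivlMr// mul1r; apply: (le_trans WK).
  rewrite -[leLHS]mulr1 -mulrA ler_wpM2l// -expRD -[leLHS]expR0 ler_expR subr_ge0.
  apply: ler_pM => //; first by rewrite subr_ge0 ler1n Npulls.
    exact: (bregman_ge0 tangent).
  by rewrite lerBlDr natr1 ler_nat; exact: ltnW lt.
rewrite -mulr_sumr ler_wpM2l ?(ltW C0)//.
apply: le_trans (sum_pr_few_pulls_le T a n.+1); apply: ler_sum => t _; apply: pr_le.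
- by apply: measurableI => //; exact: hm (hE t).
- by apply: measurableI => //; exact: hm (@hp t t a (fun k => (k < n.+1)%N) (leqnn t)).
- by move=> w [[_ [_ [lt _]]] Iw].
Qed.

(** The tail, beyond [k0] pulls, of the geometric series of Chernoff's bounds; it vanishes uniformly
    in the round. *)
Lemma pr_late_underestimate_le a x dlt : Theta x -> x <= th a ->
  (x < th a \/ forall w, Theta w -> x <= w) -> 0 < dlt ->
  exists k0 : nat, forall t, pr ([set w | (k0 < pulls t a w)%N] `&` [set w | emp_mean t a w < M
    x]) <= dlt.
Proof.
move=> Tx _ H d0.
have mE k t : measurable ([set w | (k < pulls t a w)%N] `&` [set w | emp_mean t a w < M x]).
  refine (hm (t:=t) _); apply: histI; first exact: (@hp t t a (fun l => (k < l)%N) (leqnn t)).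
  rewrite (_ : [set w | _] = ~` [set w | M x <= emp_mean t a w]).
    by apply: histC; exact: hist_emp_ge.
  by apply/seteqP; split => w /=; rewrite ltNge => /negP.
case: H => [xa|xmin]; last first.
  exists 0%N => t; rewrite (pr_null _ mN PN) ?ltW// => w [/= p0 ex].
  apply: contrapT => nN; have [u Tu eu] := Nmean nN p0; move: ex; rewrite eu ltNge.
  by rewrite (mean_le tangent) ?xmin.
pose c := D x (th a).
have c0 : 0 < c by apply: (bregman_gt0 itv tangent strict) => //; rewrite lt_eqF.
have q1 : expR (- c) < 1 by rewrite -expR0 ltr_expR oppr_lt0.
pose G := (1 - expR (- c))^-1.
have G0 : 0 < G by rewrite invr_gt0 subr_gt0.
(* Ensures [G / dlt <= k0.+1 * c <= exp (k0.+1 * c)]. *)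
pose k0 := (Num.truncn (G / dlt / c)).
have hk0 : G / dlt / c < k0.+1%:R by exact: truncnS_gt.
exists k0 => t.
apply: (@le_trans _ _ (\sum_(k < t) pr (hit t a (k0 + k).+1 `]-oo, M x]))).
  apply: (@pr_le_bigcup _ _ _ P _ t (fun k => hit t a (k0 + k).+1 `]-oo, M x])) => //.
    by move=> k; exact: hm (@hh _ _ _ _ (measurable_itv _)).
  move=> w [/= lt ex]; exists (pulls t a w - k0.+1)%N.
    by rewrite -(ltn_add2r k0.+1) subnK// (leq_ltn_trans (pulls_max I t a w))// -addSnnS leq_addr.
  exists ord_max; split => /=; first by rewrite -addSn addnC subnK.
  by rewrite in_itv/= ltW.
apply: (@le_trans _ _ (\sum_(k < t) expR (- (k0.+1%:R * c)) * expR (- (k%:R * c)))).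
  apply: ler_sum => k _; apply: le_trans (pr_hit_lower t _ Tx (ltW xa)) _ => //.
  by rewrite -addSn natrD mulrDl opprD expRD.
rewrite -mulr_sumr; apply: (@le_trans _ _ (expR (- (k0.+1%:R * c)) * G)).
  by rewrite ler_wpM2l ?expR_ge0// sum_expRN_le.
rewrite expRN mulrC ler_pdivrMr ?expR_gt0// mulrC -ler_pdivrMr//.
apply: (@le_trans _ _ (k0.+1%:R * c)).
  by rewrite -ler_pdivrMr// ltW.
by apply: le_trans (expR_ge1Dx _); rewrite lerDr.
Qed.

(** A mean below [v] requires one of the at most [k] rewards to be below [v]. This handles small
    counts, where Chernoff's bound is too weak. *)
Lemma pr_small_reward_le t a k v :
  pr ([set w | (0 < pulls t a w < k.+1)%N] `&` [set w | emp_mean t a w < v])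
  <= k%:R * fine (nu a `]-oo, v[%classic).
Proof.
pose B := `]-oo, v[%classic : set (measurableTypeR R).
have mB : measurable B by exact: measurable_itv.
pose G i := [set w | (pulls i a w < k)%N] `&` arm i a `&` r i.+1 @^-1` B.
have hG i : hist i [set w | (pulls i a w < k)%N].
  exact: (@hp i i a (fun n => (n < k)%N) (leqnn i)).
have mG i : measurable (G i).
  apply: measurableI; first by apply: measurableI => //; exact: hm (hG i).
  by rewrite -[X in measurable X]setTI; exact: (measurable_funP (r i.+1)).
have mE : measurable ([set w | (0 < pulls t a w < k.+1)%N] `&` [set w | emp_mean t a w < v]).
  refine (hm (t:=t) _); apply: histI.
    exact: (@hp t t a (fun n => (0 < n < k.+1)%N) (leqnn t)).
  rewrite (_ : [set w | _] = [set w | B (emp_mean t a w)]); first exact: he.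
  by apply/seteqP; split => w; rewrite /B /= in_itv.
apply: (@le_trans _ _ (\sum_(i < t) pr (G i))).
  apply: (@pr_le_bigcup _ _ _ P _ t G) => // w [/= /andP[p0 pk] ev].
  apply: contrapT => H; move: ev; apply/negP; rewrite -leNgt /Defs.emp_mean.
  rewrite ler_pdivlMr ?ltr0n// /Defs.pulls natr_sum mulr_sumr [leRHS]big_mkcond/=.
  rewrite !big_add1 /= !big_mkord; apply: ler_sum => i _.
  case: eqP => [e|_]; last by rewrite mulr0.
  rewrite mulr1 leNgt; apply/negP => rv; apply: H; exists i => //.
  split; last by rewrite /B /= in_itv.
  split => //=; rewrite -ltnS; apply: leq_trans pk; rewrite ltnS.
  have := pulls_le I a w (ltn_ord i); rewrite pullsS e eqxx addn1.
  by move=> h; apply: leq_trans h _.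
apply: (@le_trans _ _ (\sum_(i < t) pr ([set w | (pulls i a w < k)%N] `&` arm i a) * fine (nu a
  B))).
  apply: ler_sum => i _; rewrite /real_pr hrewards// fineM ?fin_num_measure//.
  by apply: measurableI => //; exact: hm (hG i).
by rewrite -mulr_suml ler_wpM2r ?fine_ge0// sum_pr_few_pulls_le.
Qed.

Let hist_best t c : hist t [set w | forall c', emp_mean t c' w <= emp_mean t c w].
Proof.
apply: (hist_forall (A := fun c' => [set w | emp_mean t c' w <= emp_mean t c w])) => c'.
have me e : measurable_fun setT (emp_mean t e : past I r t -> R).
  by move=> _ A mA; rewrite setTI; exact: he.
have mt : measurable [set true] by [].
have := measurable_fun_ler (me c') (me c) measurableT mt.
by rewrite setTI.
Qed.

(** If some arm is overestimated, so is the arm of largest empirical mean, which is pulled with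
    probability at least [1 / K]. The rounds are thus at most [K] times the pulls of overestimated
    arms, already bounded. *)
Lemma sum_pr_best_overestimate_le a1 z : (forall c, th c <= th a1) ->
  Theta z -> th a1 <= z -> (th a1 < z \/ forall w, Theta w -> w <= z) ->
  exists C : R, forall T,
  \sum_(t < T) pr ([set w | (K <= t)%N] `&` [set w | exists c, M z < emp_mean t c w]) <= C.
Proof.
move=> best Tz az Hz.
have /choice[C CP] : forall c, exists C : R, 0 <= C /\ forall T,
    \sum_(t < T) pr ([set w | (0 < pulls t c w)%N] `&`
      [set w | `]M z, +oo[%classic (emp_mean t c w)] `&` arm t c) <= C.
  move=> c; have [||C C0 HC] := @sum_pr_overestimate_le c z Tz.
  - exact: le_trans (best c) az.
  - by case: Hz => Hz; [left; exact: le_lt_trans (best c) Hz|right].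
  - by exists C.
pose G t c := [set w | (K <= t)%N] `&` ([set w | (0 < pulls t c w)%N] `&`
  ([set w | `]M z, +oo[%classic (emp_mean t c w)] `&`
   [set w | forall c', emp_mean t c' w <= emp_mean t c w])).
have hG t c : hist t (G t c).
  apply: histI; first exact: hc.
  apply: histI; first exact: (@hp t t c (fun k => (0 < k)%N) (leqnn t)).
  apply: histI; first exact: (@he t c `]M z, +oo[%classic).
  exact: hist_best.
have mE t : measurable ([set w | (K <= t)%N] `&` [set w | exists c, M z < emp_mean t c w]).
  refine (hm (t:=t) _); apply: histI; first exact: hc.
  apply: (hist_exists (A := fun c => [set w | M z < emp_mean t c w])) => c.
  rewrite (_ : [set w | _] = [set w | `]M z, +oo[%classic (emp_mean t c w)]); first exact: he.
  by apply/seteqP; split => w /=; rewrite in_itv/= andbT.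
exists (\sum_c K%:R * C c) => T.
apply: (@le_trans _ _ (\sum_(t < T) \sum_c pr (G t c))).
  apply: ler_sum => t _.
  apply: (@le_trans _ _ (pr (([set w | (K <= t)%N] `&` [set w | exists c, M z < emp_mean t c w])
    `\` N))).
    by apply: pr_off_null => //; exact: measurableD.
  apply: (@pr_le_bigcup_fin _ _ _ P _ _ (G t)) => //.
  - exact: measurableD.
  - by move=> c; exact: hm (hG t c).
  - move=> w [[/= Kt [c zc]] nN].
    have [cm _ cmP] := max_armE (fun a => emp_mean t a w) K0.
    exists cm; split => //; split => /=; first exact: Npulls.
    by split => //; rewrite in_itv/= andbT; exact: lt_le_trans zc (cmP c).
rewrite exchange_big/=; apply: ler_sum => c _.
apply: (@le_trans _ _ (\sum_(t < T) K%:R * pr (G t c `&` arm t c))).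
  apply: ler_sum => t _; apply: pull_ge => //; first by rewrite ltr0n.
  move=> w [/= Kt [p0 [_ cmax]]] nN.
  have [q [c1 [W [qP qc /andP[W1 WK] ->]]]] := policyE Kt nN.
  have [Tc ec] := qP c; have [Tc1 ec1] := qP c1.
  have e : q c = q c1.
    apply/eqP; rewrite eq_le qc/= -(mean_leE tangent strict)// -ec -ec1; exact: cmax.
  rewrite e bregmanxx mulr0 oppr0 expR0 mul1r ler_pdivlMr ?mul1r//.
  exact: lt_le_trans ltr01 W1.
rewrite -mulr_sumr ler_wpM2l//; have [_ HC] := CP c; apply: le_trans (HC T).
apply: ler_sum => t _; apply: pr_le.
- by apply: measurableI => //; exact: hm (hG t c).
- apply: measurableI => //; refine (hm (t:=t) _); apply: histI.
    exact: (@hp t t c (fun k => (0 < k)%N) (leqnn t)).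
  exact: (@he t c `]M z, +oo[%classic).
- by move=> w [[_ [p0 [ez _]]] Iw].
Qed.

Lemma sum_pr_rare_pulls_le a a1 x z dlt : (forall c, th c <= th a1) ->
  Theta x -> x <= th a -> (x < th a \/ forall w, Theta w -> x <= w) ->
  Theta z -> th a1 <= z -> (th a1 < z \/ forall w, Theta w -> w <= z) ->
  (forall e : R, 0 < e -> exists2 x0, Theta x0 & fine (nu a `]-oo, M x0[%classic) <= e) ->
  0 < dlt -> exists C : R, forall n T,
  \sum_(t < T) pr ([set w | (K <= t)%N] `&` [set w | (pulls t a w < n.+1)%N])
  <= C + K%:R * expR (n%:R * D x z) * n.+1%:R + dlt * T%:R.
Proof.
move=> best Tx xa Hx Tz az Hz tight d0.
have [C0 HC0] := sum_pr_best_overestimate_le best Tz az Hz.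
have d2 : 0 < dlt / 2 by rewrite divr_gt0.
(* First [k0], beyond which means below [M x] are unlikely; then [x0], depending on [k0], such that
   means below [M x0] are unlikely within [k0] pulls. The remaining early rounds, with [x0] and [k0]
   in place of [x] and [n], contribute a constant. *)
have [k0 Hk0] := pr_late_underestimate_le Tx xa Hx d2.
have [|x0 Tx0 Hx0] := tight (dlt / 2 / k0.+1%:R); first by rewrite divr_gt0// ltr0n.
exists (C0 + K%:R * expR (k0%:R * D x0 z) * k0.+1%:R) => n T.
pose LC y k t := [set w | (K <= t)%N] `&` ([set w | forall c, emp_mean t c w <= M z] `&`
    ([set w | (pulls t a w < k.+1)%N] `&` [set w | M y <= emp_mean t a w])).
pose E (t i : nat) : set Omega := match i with
  | 0 => [set w | (K <= t)%N] `&` [set w | exists c, M z < emp_mean t c w]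
  | 1 => LC x n t
  | 2 => LC x0 k0 t
  | 3 => [set w | (k0 < pulls t a w)%N] `&` [set w | emp_mean t a w < M x]
  | _ => [set w | (0 < pulls t a w < k0.+1)%N] `&` [set w | emp_mean t a w < M x0] end.
pose B i : R := match i with
  | 0 => C0 | 1 => K%:R * expR (n%:R * D x z) * n.+1%:R
  | 2 => K%:R * expR (k0%:R * D x0 z) * k0.+1%:R | _ => dlt / 2 * T%:R end.
have hlt t y : hist t [set w | emp_mean t a w < M y].
  rewrite (_ : [set w | _] = [set w | `]-oo, M y[%classic (emp_mean t a w)]); first exact: he.
  by apply/seteqP; split => w /=; rewrite in_itv.
have hLC y k t : hist t (LC y k t).
  apply: histI; first exact: hc.
  apply: histI; first exact: hforall_le.
  by apply: histI; [exact: (@hp t t a (fun l => (l < k.+1)%N) (leqnn t))|exact: hist_emp_ge].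
have hE t i : hist t (E t i).
  case: i => [|[|[|[|i]]]] //.
  - apply: histI; first exact: hc.
    apply: (hist_exists (A := fun c => [set w | M z < emp_mean t c w])) => c.
    rewrite (_ : [set w | _] = [set w | `]M z, +oo[%classic (emp_mean t c w)]); first exact: he.
    by apply/seteqP; split => w /=; rewrite in_itv/= andbT.
  - exact: hLC.
  - exact: hLC.
  - by apply: histI => //; exact: (@hp t t a (fun k => (k0 < k)%N) (leqnn t)).
  - by apply: histI => //; exact: (@hp t t a (fun k => (0 < k < k0.+1)%N) (leqnn t)).
pose S t := [set w | (K <= t)%N] `&` [set w | (pulls t a w < n.+1)%N].
have mS t : measurable (S t).
  refine (hm (t:=t) _); apply: histI; first exact: hc.
  exact: (@hp t t a (fun k => (k < n.+1)%N) (leqnn t)).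
apply: (@le_trans _ _ (\sum_(i < 5) B i)); last first.
  by rewrite !big_ord_recr big_ord0 /=; lra.
apply: (@sum_le_exchange _ T 5 (fun t i => pr (E t i)) B (fun t => pr (S t))).
  move=> t tT; apply: (@le_trans _ _ (pr (S t `\` N))).
    by apply: pr_off_null => //; exact: measurableD.
  apply: (@pr_le_bigcup _ _ _ P _ 5 (E t)).
  - exact: measurableD.
  - by move=> i; exact: hm (hE t i).
  move=> w [[/= Kt pn] nN]; have p0 := Npulls nN a Kt.
  have [H|H] := pselect (exists c, M z < emp_mean t c w); first by exists 0%N.
  have {}H c : emp_mean t c w <= M z.
    by rewrite leNgt; apply/negP => h; apply: H; exists c.
  have [xe|ex] := leP (M x) (emp_mean t a w); first by exists 1%N.
  have [kp|pk] := ltnP k0 (pulls t a w); first by exists 3%N.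
  have [xe0|ex0] := leP (M x0) (emp_mean t a w); first by exists 2%N.
  by exists 4%N => //; split => //=; rewrite p0 ltnS.
have sumT (f : nat -> R) (e : R) : (forall t, f t <= e) -> \sum_(t < T) f t <= e * T%:R.
  move=> fe; apply: (@le_trans _ _ (\sum_(t < T) e)); first by apply: ler_sum => t _.
  by rewrite sumr_const card_ord mulr_natr.
case=> [|[|[|[|[|//]]]]] _.
- exact: HC0.
- exact: sum_pr_low_count_le.
- exact: sum_pr_low_count_le.
- by apply: (sumT (fun t => pr (E t 3%N))) => t; exact: Hk0.
- apply: (sumT (fun t => pr (E t 4%N))) => t; apply: le_trans (pr_small_reward_le _ _ _ _) _.
  apply: (@le_trans _ _ (k0%:R * (dlt / 2 / k0.+1%:R))); first by rewrite ler_wpM2l.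
  rewrite mulrCA -[leRHS]mulr1 ler_wpM2l ?(ltW d2)//.
  by rewrite ler_pdivrMr ?ltr0n// mul1r ler_nat.
Qed.

Lemma exp_pulls_lower a a1 x z eps : (forall c, th c <= th a1) -> th a < th a1 ->
  Theta x -> x <= th a -> (x < th a \/ forall w, Theta w -> x <= w) ->
  Theta z -> th a1 <= z -> (th a1 < z \/ forall w, Theta w -> w <= z) ->
  (forall e : R, 0 < e -> exists2 x0, Theta x0 & fine (nu a `]-oo, M x0[%classic) <= e) ->
  0 < eps < 1 -> exists T0 : nat, forall T, (T0 <= T)%N ->
  (1 - eps) ^+ 2 * (ln T%:R / D x z) <= exp_pulls a T.
Proof.
move=> best aa1 Tx xa Hx Tz az Hz tight /andP[e0 e1].
(* One quarter for the rare rounds and one for the negligible terms; as [T - K >= T / 2] once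
   [T >= 2 * K], the probability of few pulls is then at most [eps]. *)
have d0 : 0 < eps / 4 by rewrite divr_gt0.
have [C HC] := sum_pr_rare_pulls_le best Tx xa Hx Tz az Hz tight d0.
have D0 : 0 < D x z.
  apply: (bregman_gt0 itv tangent strict) => //; rewrite lt_eqF//.
  by rewrite (le_lt_trans xa)// (lt_le_trans aa1).
have K00 : 0 <= (K%:R : R) by [].
have [T0 HT0] := eventually_small C K00 D0 e0 d0.
exists (maxn T0 (maxn K.*2 1)) => T; rewrite !geq_max => /and3P[TT0 TK T1].
have L0 : 0 <= ln (T%:R : R) by rewrite ln_ge0// ler1n.
have Tpos : 0 < (T%:R : R) by rewrite ltr0n.
(* This gives one factor [1 - eps]; the other is the probability of more than [n] pulls. *)
pose u := (1 - eps) * (ln T%:R / D x z).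
have u0 : 0 <= u by rewrite mulr_ge0 ?subr_ge0 ?(ltW e1)// divr_ge0// ltW.
pose n := Num.truncn u.
have nu_ : n%:R <= u by rewrite truncn_le.
have un : u < n.+1%:R by exact: truncnS_gt.
pose S t := [set w | (K <= t)%N] `&` [set w | (pulls t a w < n.+1)%N].
have hSt t : hist t [set w | (pulls t a w < n.+1)%N].
  exact: (@hp t t a (fun k => (k < n.+1)%N) (leqnn t)).
have mS t : measurable (S t) by refine (hm (t:=t) _); apply: histI => //; exact: hc.
pose p := pr [set w | (pulls T a w < n.+1)%N].
have p0 : 0 <= p by exact: pr_ge0.
(* Counts never decrease, so having few pulls at round [T] implies the same at every earlier
   round. *)
have h1 : (T%:R - K%:R) * p <= \sum_(t < T) pr (S t).
  apply: (@le_trans _ _ (\sum_(t < T) (K <= t)%N%:R * p)).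
    rewrite -mulr_suml ler_wpM2r//.
    have : \sum_(t < T) ((K <= t)%N%:R + (t < K)%N%:R) = T%:R :> R.
      rewrite (eq_bigr (fun=> 1)) => [|t _]; first by rewrite sumr_const card_ord.
      by rewrite ltnNge; case: (K <= t)%N; rewrite /= ?addr0 ?add0r.
    rewrite big_split/= => <-; rewrite lerBlDr lerD2l -natr_sum ler_nat.
    exact: sum_ltn_le.
  apply: ler_sum => t _; case Kt : (K <= t)%N; last by rewrite mul0r pr_ge0.
  rewrite mul1r; apply: pr_le => //; first exact: hm (hSt T).
  move=> w /= lt; split => //=; apply: leq_ltn_trans lt.
  by apply: pulls_le; exact: ltnW.
have h2 : K%:R * expR (n%:R * D x z) * n.+1%:R <=
    K%:R * (T%:R * expR (- (eps * ln T%:R)) * (ln T%:R / D x z + 1)).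
  rewrite -mulrA ler_wpM2l//; apply: ler_pM => //.
    rewrite -[X in X * expR _](lnK (_ : _ \is Num.pos)) ?posrE// -expRD ler_expR.
    have -> : ln T%:R - eps * ln T%:R = u * D x z by rewrite /u; field; rewrite gt_eqF.
    by rewrite ler_wpM2r// ltW.
  rewrite -natr1 lerD2r; apply: (le_trans nu_); rewrite /u ler_piMl ?divr_ge0 ?(ltW D0)//.
  by rewrite gerBl ltW.
have h3 : p <= eps.
  have h4 := HT0 T TT0; have h5 := HC n T.
  have h6 : (T%:R - K%:R) * p <= eps / 2 * T%:R.
    apply: (le_trans h1); apply: (le_trans h5).
    move: h2 h4; move: (K%:R * expR _ * _) (K%:R * (_ * _)) => X Y; lra.
  have h7 : T%:R / 2 <= T%:R - K%:R :> R.
    have : (K.*2%:R : R) <= T%:R by rewrite ler_nat.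
    by rewrite -muln2 natrM; lra.
  have h8 : T%:R / 2 * p <= eps / 2 * T%:R by apply: le_trans h6; rewrite ler_wpM2r.
  have : T%:R / 2 * p <= T%:R / 2 * eps by apply: (le_trans h8); lra.
  by rewrite ler_pM2l// divr_gt0.
apply: le_trans (exp_pulls_ge a T n.+1).
rewrite (_ : [set w | (n < pulls T a w)%N] = ~` [set w | (pulls T a w < n.+1)%N]); last first.
  by apply/seteqP; split => w /=; [move=> ?; apply/negP; rewrite -leqNgt|move/negP; rewrite
    -leqNgt].
rewrite pr_setC; last exact: hm (hSt T).
rewrite expr2 -mulrA [leLHS]mulrC -/u -/p; apply: ler_pM => //.
- by rewrite subr_ge0 ltW.
- exact: ltW.
- by rewrite lerB.
Qed.

Lemma exp_pulls_rate a a1 : (forall c, th c <= th a1) -> th a < th a1 ->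
  (forall e : R, 0 < e -> exists2 x0, Theta x0 & fine (nu a `]-oo, M x0[%classic) <= e) ->
  exp_pulls a T / ln T%:R @[T --> \oo] --> (D (th a) (th a1))^-1.
Proof.
move=> best aa1 tight; set D0 := D (th a) (th a1).
have D0_gt0 : 0 < D0 by apply: (bregman_gt0 itv tangent strict) => //; rewrite lt_eqF.
have D0V : 0 < D0^-1 by rewrite invr_gt0.
apply: cvg_div_ln => c.
  move=> hlt; have c0 : 0 < c by exact: lt_trans hlt.
  have cD : c^-1 < D0 by rewrite -[D0]invrK ltf_pV2 ?posrE.
  have e0 : 0 < D0 - c^-1 by rewrite subr_gt0.
  have [x [y [Tx Ty /andP[ax xy] ya Dxy]]] :=
    bregman_inner itv tangent strict near_mean (hth a) (hth a1) aa1 e0.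
  have {}Dxy : c^-1 <= D x y by move: Dxy; rewrite -/D0 opprB addrCA subrr addr0.
  have [C HC] := exp_pulls_upper Tx Ty ax xy ya.
  exists C => T T0; apply: (le_trans (HC T T0)); rewrite lerD2r mulrC.
  rewrite ler_wpM2r ?ln_ge0 ?ler1n//.
  by rewrite -[c]invrK lef_pV2 ?posrE ?invr_gt0// (lt_le_trans _ Dxy) ?invr_gt0.
move=> clt; have [c0|c0] := leP c 0.
  exists 1%N => T T1; apply: (@le_trans _ _ 0).
    by rewrite mulr_le0_ge0 ?ln_ge0 ?ler1n.
  by apply: sumr_ge0 => t _; exact: pr_ge0.
have cD : c * D0 < 1 by rewrite -ltr_pdivlMr// mul1r.
(* Chosen so that [c * (D0 + eps) = 1 - 2 * eps <= (1 - eps) ^ 2]. *)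
pose eps := (1 - c * D0) / (2 + c).
have c2 : 0 < 2 + c by rewrite addr_gt0.
have e0 : 0 < eps by rewrite divr_gt0 ?subr_gt0.
have e1 : eps < 1.
  rewrite ltr_pdivrMr// mul1r; have : 0 < c * D0 by rewrite mulr_gt0.
  lra.
have [x [z [Tx Tz [xa az] [Hx Hz] Dxz]]] :=
  bregman_outer itv tangent strict near_mean (hth a) (hth a1) aa1 e0.
have D1 : 0 < D x z.
  apply: (bregman_gt0 itv tangent strict) => //; rewrite lt_eqF//.
  by rewrite (le_lt_trans xa)// (lt_le_trans aa1).
have e01 : 0 < eps < 1 by rewrite e0.
have [||T0 HT0] := exp_pulls_lower best aa1 Tx xa _ Tz az _ tight e01.
- by case: Hx => [|Hx]; [left|right => w Tw; exact: le_trans xa (Hx w Tw)].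
- by case: Hz => [|Hz]; [left|right => w Tw; exact: le_trans (Hz w Tw) az].
exists (maxn T0 1) => T; rewrite geq_max => /andP[TT0 T1].
apply: le_trans (HT0 T TT0); rewrite mulrCA mulrC ler_wpM2l ?ln_ge0 ?ler1n//.
rewrite ler_pdivlMr//; apply: (@le_trans _ _ (c * (D0 + eps))); first by rewrite ler_pM2l.
have h : eps * (2 + c) = 1 - c * D0 by rewrite /eps divfK// gt_eqF.
have : 0 <= eps ^+ 2 by rewrite sqr_ge0.
rewrite sqrrB expr1n mul1r mulr2n; move: h; lra.
Qed.

End bandit.

(** * Regret *)

(** Three cases: a minimum of [S], below which [rho] has no mass; an infimum not attained, at which
    the distribution function vanishes and is right-continuous; no lower bound, where it tends to
    0. *)
Lemma lower_tail_small {R : realType} (rho : probability (measurableTypeR R) R) (S : set R) :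
  S !=set0 ->
  (forall B : set (measurableTypeR R), measurable B -> B `&` S = set0 -> rho B = 0%E) ->
  forall e : R, 0 < e -> exists2 s, S s & fine (rho `]-oo, s[%classic) <= e.
Proof.
move=> S0 HS e e0.
have [[s Ss smin]|nomin] := pselect (exists2 s, S s & forall x, S x -> s <= x).
  exists s => //; rewrite HS ?(ltW e0)//; apply/seteqP; split => // x [/=].
  by rewrite in_itv/= => xs /smin; rewrite leNgt xs.
have mid : measurable_fun setT (idfun : measurableTypeR R -> R) by exact: measurable_id.
pose X : {RV rho >-> R} := HB.pack (idfun : measurableTypeR R -> R)
  (isMeasurableFun.Build _ _ _ _ (idfun : measurableTypeR R -> R) mid).
have tail s : fine (rho `]-oo, s[%classic) <= fine (cdf X s).
  rewrite (_ : cdf X s = rho `]-oo, s]%classic)//.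
  rewrite fine_le ?fin_num_measure//; apply: le_measure; rewrite ?inE//.
  by move=> x /=; rewrite !in_itv/= => /ltW.
have [lbS|nlbS] := pselect (has_lbound S).
  pose l := inf S.
  have hinf : has_inf S by [].
  have lS x : S x -> l < x.
    move=> Sx; rewrite lt_neqAle (ge_inf lbS)// andbT; apply/eqP => lx.
    by apply: nomin; exists x => // y Sy; rewrite -lx; exact: (ge_inf lbS).
  have c0 : cdf X l = 0%E.
    rewrite (_ : cdf X l = rho `]-oo, l]%classic)//.
    apply: HS => //; apply/seteqP; split => // x [/=].
    by rewrite in_itv/= => xl /lS; rewrite ltNge xl.
  have := @cdf_right_continuous _ _ _ _ X l; rewrite c0 => /fine_cvg /cvgr_lt /(_ _ e0).
  rewrite near_withinE /= => /nbhs_ballP[dl /= dl0 H].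
  have [s Ss sl] := inf_adherent dl0 hinf.
  exists s => //; apply: (le_trans (tail s)); apply/ltW/H; last exact: lS.
  by rewrite /ball/= distrC gtr0_norm ?subr_gt0 ?lS// ltrBlDl.
have := @cvg_cdfNy0 _ _ _ _ X => /fine_cvg /cvgr_lt /(_ _ e0) [A [_ HA]].
have [s Ss sA] : exists2 s, S s & s < A.
  apply: contrapT => H; apply: nlbS; exists A => s Ss; rewrite leNgt.
  by apply/negP => sA; apply: H; exists s.
by exists s => //; apply: (le_trans (tail s)); apply/ltW/HA.
Qed.

Section regret.
Context {R : realType} {d : measure_display} {Omega : measurableType d}.
Variables (P : probability Omega R) (K : nat) (I : nat -> Omega -> 'I_K).
Hypothesis hI : forall t a, measurable (I t @^-1` [set a]).

Lemma regret_exp_pulls (mu : 'I_K -> R) T : (forall a, mu a <= max_arm mu) ->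
  regret P I mu T = (\sum_a (max_arm mu - mu a) * exp_pulls P I a T)%:E.
Proof.
move=> mumax; rewrite /regret expectation.unlock.
pose g (p : 'I_T * 'I_K) (w : Omega) : R :=
  (max_arm mu - mu p.2) * \1_(I p.1.+1 @^-1` [set p.2]) w.
transitivity (\int[P]_w \sum_p (g p w)%:E)%E.
  apply: eq_integral => w _; rewrite sumEFin; congr (_%:E).
  rewrite -(pair_bigA _ (fun t a => g (t, a) w))/= big_add1 /= big_mkord.
  apply: eq_bigr => t _; rewrite (bigD1 (I t.+1 w))//= big1 ?addr0.
    by rewrite /g/= indicE mem_set//= mulr1.
  move=> a aI; rewrite /g/= indicE memNset ?mulr0//= => e.
  by move: aI; rewrite e eqxx.
have mg p : measurable_fun setT (fun w => (g p w)%:E).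
  by apply/measurable_EFinP; apply: measurable_funM => //; exact: measurable_indic.
rewrite ge0_integral_sum//; last first.
  by move=> p w _; rewrite lee_fin mulr_ge0 ?subr_ge0.
have gE p : (\int[P]_w (g p w)%:E =
    ((max_arm mu - mu p.2) * real_pr P (I p.1.+1 @^-1` [set p.2]))%:E)%E.
  have mA := hI p.1.+1 p.2; rewrite /g; under eq_integral do rewrite EFinM.
  rewrite ge0_integralZl//=; last 2 first.
  - by apply/measurable_EFinP; exact: measurable_indic.
  - by rewrite lee_fin subr_ge0.
  rewrite EFinM -prE//; congr (_ * _)%E.
  by rewrite (integral_indic P measurableT mA) setIT.
under eq_bigr do rewrite gE.
rewrite sumEFin; congr (_%:E); rewrite /exp_pulls.
rewrite -(pair_bigA _ (fun (t : 'I_T) a => (max_arm mu - mu a) * real_pr P (I t.+1 @^-1` [set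
  a])))/=.
by rewrite exchange_big/=; apply: eq_bigr => a _; rewrite mulr_sumr.
Qed.

End regret.

(** * Initial rounds and the support of the laws of the arms *)

Section initial_rounds.
Context {R : realType} {d : measure_display} {Omega : measurableType d}.
Variables (P : probability Omega R) (K : nat).
Variables (I : nat -> Omega -> 'I_K) (r : nat -> {RV P >-> R}).
Local Notation law := (probability (measurableTypeR R) R).
Hypothesis hI : forall t a, measurable (I t @^-1` [set a]).
Variable F : set law.
Hypothesis hpolicy : follows_policy I r (expklms I r F).

Lemma initial_arm (a : 'I_K) : P (I a.+1 @^-1` [set a]) = 1%E.
Proof.
have := hpolicy a (@histT _ _ _ P K I r a); rewrite setTI => ->.
rewrite (_ : (fun w => _) = cst 1%E); last first.
  by apply/funext => w; rewrite /expklms ltn_ord eqxx.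
by rewrite (integral_cst P measurableT 1) mul1e; exact: probability_setT.
Qed.

Lemma ae_initial_arms : {ae P, forall w, forall a : 'I_K, I a.+1 w = a}.
Proof.
apply: filter_forall => a; exists (~` (I a.+1 @^-1` [set a])); split => //.
  exact: measurableC.
by rewrite probability_setC// initial_arm subee.
Qed.

Lemma initial_pulls w : (forall a : 'I_K, I a.+1 w = a) ->
  forall t a, (K <= t)%N -> (0 < pulls I t a w)%N.
Proof.
move=> Iw t a Kt; have at_ : (a.+1 <= t)%N by exact: leq_trans (ltn_ord a) Kt.
by apply: leq_trans (pulls_le I a w at_); rewrite pullsS Iw eqxx addn1.
Qed.

Lemma initial_emp_mean w (a : 'I_K) : (forall a : 'I_K, I a.+1 w = a) ->
  (0 < pulls I a.+1 a w)%N /\ emp_mean I r a.+1 a w = r a.+1 w.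
Proof.
move=> Iw; have p0 : pulls I a a w = 0%N.
  rewrite /pulls big_add1 /= big_mkord big1// => i _.
  rewrite (Iw (widen_ord (ltnW (ltn_ord a)) i)) -val_eqE /=.
  by rewrite ltn_eqF.
have p1 : pulls I a.+1 a w = 1%N by rewrite pullsS p0 Iw eqxx.
split; first by rewrite p1.
rewrite /emp_mean p1 divr1 big_add1 /= big_mkord big_mkcond big_ord_recr/= Iw eqxx.
rewrite big1 ?add0r// => i _; rewrite (Iw (widen_ord (ltnW (ltn_ord a)) i)) -val_eqE /=.
by rewrite ltn_eqF.
Qed.

(** After the first pull of [a], its empirical mean is that single reward, so the assumption on
    empirical means constrains the law [nu a] itself. *)
Lemma law_support (nu : 'I_K -> law) (S : set R) (N : set Omega) a (B : set (measurableTypeR R)) :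
  bandit_rewards I r nu -> measurable N -> P N = 0%E ->
  (forall w, ~ N w -> forall a : 'I_K, I a.+1 w = a) ->
  (forall w, ~ N w -> forall t a, (0 < pulls I t a w)%N -> S (emp_mean I r t a w)) ->
  measurable B -> B `&` S = set0 -> nu a B = 0%E.
Proof.
move=> hrewards mN PN NI NS mB BS.
have := hrewards a setT a B (@histT _ _ _ P K I r a) mB; rewrite setTI initial_arm mul1e => <-.
apply: (subset_measure0 _ mN) => //.
  apply: measurableI => //; rewrite -[X in measurable X]setTI.
  exact: (measurable_funP (r a.+1)).
move=> w [_ /= Bw]; apply: contrapT => nN.
have [p0 e] := initial_emp_mean a (NI w nN).
have := NS w nN _ _ p0; rewrite e => Sw.
suff : (B `&` S) (r a.+1 w) by rewrite BS.
by split.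
Qed.

End initial_rounds.

(** * The limit of the regret *)

Unset Implicit Arguments.

Theorem corollary6 (R : realType)
  (m : {measure set (measurableTypeR R) -> \bar R}) (Theta : set R)
  (b' b'' : R -> R) (V : R)
  (K : nat) (nu : 'I_K -> probability (measurableTypeR R) R)
  (d : measure_display) (Omega : measurableType d) (P : probability Omega R)
  (I : nat -> Omega -> 'I_K) (r : nat -> {RV P >-> R})
  (mu := fun a => fine (mean (nu a)))
  (Delta := fun a => max_arm mu - mu a)
  (hTheta : is_interval Theta)
  (hfin : forall theta, Theta theta -> (0 < laplace m theta < +oo)%E)
  (hb' : forall theta, Theta theta ->
    is_derive_in Theta (log_partition m) theta (b' theta))
  (hb'' : forall theta, Theta theta ->
    is_derive_in Theta b' theta (b'' theta))
  (hb''_cont : {within Theta, continuous b''})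
  (hb''_pos : forall theta, Theta theta -> 0 < b'' theta)
  (hV : forall rho, expfam m Theta rho -> ('V_rho[idfun] <= V%:E)%E)
  (hK : (2 <= K)%N)
  (hnu : forall a, expfam m Theta (nu a))
  (hI : forall t a, measurable (I t @^-1` [set a]))
  (hrewards : bandit_rewards I r nu)
  (hemp : {ae P, forall w, forall t a, (0 < pulls I t a w)%N ->
    exists2 rho, expfam m Theta rho & mean rho = (emp_mean I r t a w)%:E})
  (hpolicy : follows_policy I r (expklms I r (expfam m Theta))) :
  limn_esup (fun T => (regret P I mu T * ((ln T%:R)^-1)%:E)%E) =
  (\sum_(a < K | 0 < Delta a)
     Delta a / KL (expfam m Theta) (mu a) (max_arm mu))%:E.
Proof.
pose b := log_partition m; pose M := param_mean m.
have K0 : (0 < K)%N by exact: ltnW.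
have tg u v : Theta u -> Theta v -> b u + M u * (v - u) <= b v.
  by move=> Tu Tv; exact: (log_partition_tangent hfin hV).
have strict u v : Theta u -> Theta v -> u < v -> M u < M v.
  exact: (mean_lt hTheta tg hb' hb'' hb''_pos).
have near_mean u v : Theta u -> Theta v -> forall e : R, 0 < e ->
    exists k : R, 0 < k <= 1 /\ `|M (u + k * (v - u)) - M u| < e.
  by move=> Tu Tv e; exact: (param_mean_near hTheta hfin hV).
have inj u v : Theta u -> Theta v -> M u = M v -> u = v.
  exact: (mean_inj tg strict).
have hKL u v : Theta u -> Theta v -> KL (expfam m Theta) (M u) (M v) = bregman b M u v.
  by move=> Tu Tv; exact: (KL_param hfin hV).
have /choice[th thP] : forall a, exists u, Theta u /\ has_param m u (nu a).
  by move=> a; have [u Tu hu] := hnu a; exists u.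
have hth a : Theta (th a) by have [] := thP a.
have hmgf a v : Theta v ->
    (\int[nu a]_x (expR ((v - th a) * x - (b v - b (th a))))%:E = 1)%E.
  move=> Tv; under eq_integral do rewrite [(v - th a) * _]mulrC.
  by have [_ hp] := thP a; exact: (mgf_param hfin Tv hp).
have muE a : mu a = M (th a).
  by have [Ta hp] := thP a; rewrite /mu (mean_param hV Ta hp).
have [a1 mumax mule] := max_armE mu K0.
have best c : th c <= th a1.
  by move: (mule c); rewrite (muE c) (muE a1) (mean_leE tg strict (hth c) (hth a1)).
have [N [mN PN HN]] : exists N, [/\ measurable N, P N = 0%E & forall w, ~ N w ->
    (forall a : 'I_K, I a.+1 w = a) /\ forall t a, (0 < pulls I t a w)%N ->
      exists2 u, Theta u & emp_mean I r t a w = M u].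
  have [N [mN PN HN]] := filterI (ae_initial_arms hI hpolicy) hemp.
  exists N; split => // w nN.
  have [Iw ew] : ((fun w => forall a : 'I_K, I a.+1 w = a) `&`
      (fun w => forall t a, (0 < pulls I t a w)%N ->
    exists2 rho, expfam m Theta rho & mean rho = (emp_mean I r t a w)%:E)) w.
    by apply: contrapT => H; apply: nN; exact: HN.
  split => // t a p0; have [rho [u Tu hu] e] := ew t a p0; exists u => //.
  by apply: EFin_inj; rewrite -e; exact: (mean_param hV).
have NI w : ~ N w -> forall a : 'I_K, I a.+1 w = a by move=> /HN[].
have Nmean w : ~ N w -> forall t a, (0 < pulls I t a w)%N ->
    exists2 u, Theta u & emp_mean I r t a w = M u by move=> /HN[].
have Npulls w : ~ N w -> forall t a, (K <= t)%N -> (0 < pulls I t a w)%N.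
  by move=> /NI; exact: initial_pulls.
(* [nu a] gives no mass to measurable sets disjoint from the means of the family, so some of these
   means have an arbitrarily small tail below them. *)
have tight a e : 0 < e -> exists2 x0, Theta x0 & fine (nu a `]-oo, M x0[%classic) <= e.
  move=> e0; have [||s [x0 Tx0 <-] H] := @lower_tail_small _ (nu a) (M @` Theta) _ _ e e0.
  - by exists (M (th a)), (th a).
  - have NS w : ~ N w -> forall t c, (0 < pulls I t c w)%N -> (M @` Theta) (emp_mean I r t c w).
      by move=> nN t c p0; have [u Tu ->] := Nmean w nN t c p0; exists u.
    by move=> B mB; exact: (law_support hI hpolicy a hrewards mN PN NI NS mB).
  - by exists x0.
have rate a : Delta a * exp_pulls P I a T / ln T%:R @[T --> \oo] -->
    (if 0 < Delta a then Delta a / KL (expfam m Theta) (mu a) (max_arm mu) else 0).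
  case: ifPn => [D0|]; last first.
    rewrite -leNgt => D0; have -> : Delta a = 0.
      by apply/eqP; rewrite eq_le D0 /Delta subr_ge0 mumax mule.
    under eq_fun do rewrite !mul0r; exact: cvg_cst.
  under eq_fun do rewrite -mulrA; apply: cvgMl_tmp.
  rewrite mumax (muE a) (muE a1) (hKL _ _ (hth a) (hth a1)).
  have lt : th a < th a1.
    rewrite ltNge; apply/negP => le.
    move: D0; rewrite /Delta mumax subr_gt0 (muE a) (muE a1) ltNge.
    by rewrite (mean_le tg (hth a1) (hth a) le).
  exact: (exp_pulls_rate hI hrewards hTheta tg strict near_mean hKL hth hmgf K0 hpolicy
    mN PN Nmean Npulls best lt (tight a)).
rewrite (_ : (fun T => _) = EFin \o (fun T => \sum_a Delta a * exp_pulls P I a T / ln T%:R));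
  last first.
  apply/funext => T /=; rewrite regret_exp_pulls//; last by rewrite mumax.
  by rewrite -EFinM mulr_suml.
(* The quotient converges, arm by arm, so its upper limit is its limit. *)
suff /cvg_limn_einf_sup[_ ->] : (EFin \o (fun T => \sum_a Delta a * exp_pulls P I a T / ln
  T%:R)) T
    @[T --> \oo] --> (\sum_(a < K | 0 < Delta a)
      Delta a / KL (expfam m Theta) (mu a) (max_arm mu))%:E by [].
apply: cvg_EFin; first by near=> T.
rewrite [X in _ --> X]big_mkcond/=.
apply: cvg_big => [|a _]; [exact: add_continuous|exact: rate].
Unshelve. all: by end_near. Qed.
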